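(* Let $H$ be a finite dimensional Hopf algebra with invertible antipode $S$ over a field $k$ of characteristic $0$. Then the functor $\widehat{(-)}:\mathcal{M}^H\to\widehat{\mathcal{M}^H}$, $M\mapsto\mathrm{Hom}(H,M)^H$, from right $H$-comodules to right $H$-contramodules is an equivalence, and so is the functor $\widehat{(-)}_H$ from anti-Yetter-Drinfeld modules to anti-Yetter-Drinfeld contramodules over $H$.
   Context: Sweedler notation: $\Delta(h)=h^1\otimes h^2$; a right coaction is $m\mapsto m_0\otimes m_1$. $\mathrm{Hom}$ denotes $k$-linear maps, $\mathrm{Hom}(-,-)^H$ right $H$-comodule maps; $f(a-b)$ means $x\mapsto f(axb)$. A right $H$-contramodule is a vector space $N$ with linear $\alpha:\mathrm{Hom}(H,N)\to N$ such that $\alpha(x\mapsto\alpha(h\mapsto f(x\otimes h)))=\alpha(h\mapsto f(h^1\otimes h^2))$ for $f\in\mathrm{Hom}(H\otimes H,N)$ and $\alpha(h\mapsto\epsilon(h)n)=n$. For a comodule $M$, $\widehat{M}=\mathrm{Hom}(H,M)^H$ has contraaction $(\alpha\theta)(h)=\theta_{h^1}(h^2)$ for $\theta:h\mapsto\theta_h$. Anti-Yetter-Drinfeld ($aYD$) module: left $H$-module and right $H$-comodule $M$ with $(hm)_0\otimes(hm)_1=h^2m_0\otimes h^3m_1S(h^1)$. $aYD$-contramodule: left $H$-module and right $H$-contramodule $N$ with $h\alpha(f)=\alpha(h^2f(S(h^3)-h^1))$. Morphisms preserve both structures. For an $aYD$-module $M$, $\widehat{M}_H$ is $\widehat{M}=\mathrm{Hom}(H,M)^H$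 with contraaction $(\alpha\theta)(h)=\theta_{h^1}(h^2)$ and $H$-action $(h\cdot\phi)(-)=h^2\phi(S(h^3)-h^1)$. *)

(* Defs.v *)
From HB Require Import structures.
From mathcomp Require Import all_boot all_algebra falgebra.
From mathcomp Require Import boolp.

Set Implicit Arguments.
Unset Strict Implicit.
Unset Printing Implicit Defensive.

Import GRing.Theory.
Local Open Scope ring_scope.
Local Open Scope quotient_scope.

Section LinearMaps.
Variables (k : fieldType) (U V : lmodType k).

Definition mklin (f : U -> V) (Lf : linear f) : {linear U -> V} :=
  HB.pack f (GRing.isLinear.Build k U V *:%R f Lf).

Lemma linear_ext (f g : {linear U -> V}) : f =1 g -> f = g.
Proof.
case: f g => [f [[[f0 fD]] [fZ]]] [g [[[g0 gD]] [gZ]]] /= /funext efg.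
move: f0 fD fZ; rewrite efg => f0 fD fZ.
by rewrite (Prop_irrelevance f0 g0) (Prop_irrelevance fD gD)
  (Prop_irrelevance fZ gZ).
Qed.

HB.instance Definition _ := gen_eqMixin {linear U -> V}.
HB.instance Definition _ := gen_choiceMixin {linear U -> V}.

Definition lin0 : {linear U -> V} := \0.
Definition linopp (f : {linear U -> V}) : {linear U -> V} := \- f.
Definition linadd (f g : {linear U -> V}) : {linear U -> V} := f \+ g.

Fact linscale_subproof (a : k) (f : {linear U -> V}) :
  linear (fun x => a *: f x).
Proof. by move=> c x y; rewrite linearP scalerDr !scalerA mulrC. Qed.
Definition linscale a f := mklin (linscale_subproof a f).

Fact linaddA : associative linadd.
Proof. by move=> f g h; apply: linear_ext => x /=; rewrite addrA. Qed.
Fact linaddC : commutative linadd.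
Proof. by move=> f g; apply: linear_ext => x /=; rewrite addrC. Qed.
Fact linadd0 : left_id lin0 linadd.
Proof. by move=> f; apply: linear_ext => x /=; rewrite add0r. Qed.
Fact linaddN : left_inverse lin0 linopp linadd.
Proof. by move=> f; apply: linear_ext => x /=; rewrite addNr. Qed.
HB.instance Definition _ :=
  GRing.isZmodule.Build {linear U -> V} linaddA linaddC linadd0 linaddN.

Fact linscaleA a b f : linscale a (linscale b f) = linscale (a * b) f.
Proof. by apply: linear_ext => x /=; rewrite scalerA. Qed.
Fact linscale1 : left_id 1 linscale.
Proof. by move=> f; apply: linear_ext => x /=; rewrite scale1r. Qed.
Fact linscaleDr : right_distributive linscale +%R.
Proof. by move=> a f g; apply: linear_ext => x /=; rewrite scalerDr. Qed.
Fact linscaleDl f : {morph linscale^~ f : a b / a + b}.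
Proof. by move=> a b; apply: linear_ext => x /=; rewrite scalerDl. Qed.
HB.instance Definition _ := GRing.Zmodule_isLmodule.Build k {linear U -> V}
  linscaleA linscale1 linscaleDr linscaleDl.

Lemma lin_addE (f g : {linear U -> V}) x : (f + g) x = f x + g x.
Proof. by []. Qed.
Lemma lin_scaleE a (f : {linear U -> V}) x : (a *: f) x = a *: f x.
Proof. by []. Qed.

End LinearMaps.

Section Tensor.
Variables (k : fieldType) (U V : lmodType k).

(* Tensors are formal finite sums of pairs, two of them being identified when
   all bilinear maps agree on them; the universal property is given by tsum_tens,
   tsum_linear and tensor_lin_ext below. *)
Definition tens_rel (s t : seq (U * V)) : bool :=
  `[< forall (W : lmodType k) (b : {bilinear U -> V -> W}),
        \sum_(p <- s) b p.1 p.2 = \sum_(p <- t) b p.1 p.2 >].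

Fact tens_rel_refl : reflexive tens_rel.
Proof. by move=> s; apply/asboolP. Qed.
Fact tens_rel_sym : symmetric tens_rel.
Proof.
by move=> s t; apply/asboolP/asboolP => e W b; rewrite e.
Qed.
Fact tens_rel_trans : transitive tens_rel.
Proof.
by move=> s t u /asboolP e /asboolP e'; apply/asboolP => W b; rewrite e e'.
Qed.
Canonical tens_equiv :=
  EquivRel tens_rel tens_rel_refl tens_rel_sym tens_rel_trans.

Definition tensor := {eq_quot tens_rel}.
HB.instance Definition _ := Quotient.on tensor.
HB.instance Definition _ := Choice.on tensor.

Definition tens (u : U) (v : V) : tensor := \pi_tensor [:: (u, v)].
Definition tens0 : tensor := \pi_tensor [::].
Definition tensD (x y : tensor) : tensor := \pi_tensor (repr x ++ repr y).
Definition tensZ (a : k) (x : tensor) : tensor :=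
  \pi_tensor [seq (a *: p.1, p.2) | p <- repr x].

(* Sweedler-style sums: \tsum_(a, b <- t) F a b is the value at t of the linear
   map induced by F.  It is computed on a chosen representative of t, so it is
   meaningful only when F is bilinear in (a, b), as in all uses below. *)
Definition tsum (W : lmodType k) (t : tensor) (b : U -> V -> W) : W :=
  \sum_(p <- repr t) b p.1 p.2.

Lemma tens_piP (s t : seq (U * V)) :
  (forall (W : lmodType k) (b : {bilinear U -> V -> W}),
    \sum_(p <- s) b p.1 p.2 = \sum_(p <- t) b p.1 p.2) <->
  \pi_tensor s = \pi_tensor t.
Proof.
split=> [e|/eqmodP/asboolP//]; by apply/eqmodP/asboolP.
Qed.

Lemma tsum_pi (W : lmodType k) s (b : {bilinear U -> V -> W}) :
  tsum (\pi_tensor s) b = \sum_(p <- s) b p.1 p.2.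
Proof. by move: W b; apply/tens_piP; rewrite reprK. Qed.

Lemma tensP (x y : tensor) :
  (forall (W : lmodType k) (b : {bilinear U -> V -> W}), tsum x b = tsum y b)
  -> x = y.
Proof. by move=> e; rewrite -[x]reprK -[y]reprK; apply/tens_piP. Qed.

Lemma tsum_tensD (W : lmodType k) x y (b : {bilinear U -> V -> W}) :
  tsum (tensD x y) b = tsum x b + tsum y b.
Proof. by rewrite tsum_pi big_cat. Qed.
Lemma tsum_tensZ (W : lmodType k) a x (b : {bilinear U -> V -> W}) :
  tsum (tensZ a x) b = a *: tsum x b.
Proof.
rewrite tsum_pi big_map scaler_sumr; apply: eq_bigr => p _ /=.
exact: linearZl_LR.
Qed.
Lemma tsum_tens0 (W : lmodType k) (b : {bilinear U -> V -> W}) :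
  tsum tens0 b = 0.
Proof. by rewrite tsum_pi big_nil. Qed.

Fact tensDA : associative tensD.
Proof. by move=> x y z; apply: tensP => W b; rewrite !tsum_tensD addrA. Qed.
Fact tensDC : commutative tensD.
Proof. by move=> x y; apply: tensP => W b; rewrite !tsum_tensD addrC. Qed.
Fact tensD0 : left_id tens0 tensD.
Proof.
by move=> x; apply: tensP => W b; rewrite tsum_tensD tsum_tens0 add0r.
Qed.
Fact tensDN : left_inverse tens0 (tensZ (-1)) tensD.
Proof.
move=> x; apply: tensP => W b.
by rewrite tsum_tensD tsum_tens0 tsum_tensZ scaleN1r addNr.
Qed.
HB.instance Definition _ := GRing.isZmodule.Build tensor
  tensDA tensDC tensD0 tensDN.

Fact tensZA a b x : tensZ a (tensZ b x) = tensZ (a * b) x.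
Proof. by apply: tensP => W f; rewrite !tsum_tensZ scalerA. Qed.
Fact tensZ1 : left_id 1 tensZ.
Proof. by move=> x; apply: tensP => W f; rewrite !tsum_tensZ scale1r. Qed.
Fact tensZDr : right_distributive tensZ +%R.
Proof.
move=> a x y; apply: tensP => W f.
by rewrite !(tsum_tensZ, tsum_tensD) scalerDr.
Qed.
Fact tensZDl x : {morph tensZ^~ x : a b / a + b}.
Proof.
move=> a b; apply: tensP => W f.
by rewrite !(tsum_tensZ, tsum_tensD) scalerDl.
Qed.
HB.instance Definition _ := GRing.Zmodule_isLmodule.Build k tensor
  tensZA tensZ1 tensZDr tensZDl.

End Tensor.

Reserved Notation "u ⊗ v" (at level 45, left associativity).
Reserved Notation "\tsum_ ( a , b <- t ) F"
  (at level 46, F at level 46, a name, b name, t at level 60,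
   format "'[' \tsum_ ( a ,  b  <-  t ) '/  '  F ']'").
Notation "u ⊗ v" := (tens u v) : ring_scope.
Notation "\tsum_ ( a , b <- t ) F" := (tsum t (fun a b => F)) : ring_scope.

Section TensorTheory.
Variables (k : fieldType) (U V W : lmodType k).

Definition bilin (b : U -> V -> W) : Prop :=
  (forall v, linear (fun u => b u v)) /\ (forall u, linear (b u)).

Definition mkbilin (b : U -> V -> W) (Bb : bilin b) : {bilinear U -> V -> W} :=
  HB.pack b (bilinear_isBilinear.Build k U V W *:%R *:%R b
    (proj1 Bb, proj2 Bb)).

Lemma bilinear_bilin (b : {bilinear U -> V -> W}) : bilin b.
Proof.
split=> [v|u] a x y; last exact: linearPr.
exact: linearPl.
Qed.

End TensorTheory.

Section TensorTheory2.
Variables (k : fieldType).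
Implicit Types U V W X : lmodType k.

Lemma tsum_tens U V W (u : U) (v : V) (b : U -> V -> W) :
  bilin b -> tsum (u ⊗ v) b = b u v.
Proof. by move=> Bb; rewrite (tsum_pi _ (mkbilin Bb)) big_seq1. Qed.

Lemma tsum_linear U V W (b : U -> V -> W) :
  bilin b -> linear (fun t : tensor U V => tsum t b).
Proof.
move=> Bb a x y; rewrite -(tsum_tensZ _ _ (mkbilin Bb)).
exact: (tsum_tensD _ _ (mkbilin Bb)).
Qed.

Lemma eq_tsum U V W (t : tensor U V) (b c : U -> V -> W) :
  (forall u v, b u v = c u v) -> tsum t b = tsum t c.
Proof. by move=> e; apply: eq_bigr. Qed.

Lemma linear_tsum U V X W (f : {linear X -> W}) (t : tensor U V) b :
  f (tsum t b) = tsum t (fun u v => f (b u v)).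
Proof. exact: linear_sum. Qed.

Lemma linf_tsum U V X W (f : X -> W) (t : tensor U V) b : linear f ->
  f (tsum t b) = tsum t (fun u v => f (b u v)).
Proof. by move=> Lf; exact: (linear_tsum (mklin Lf)). Qed.

Lemma tsumD U V W (t : tensor U V) (b c : U -> V -> W) :
  tsum t (fun u v => b u v + c u v) = tsum t b + tsum t c.
Proof. exact: big_split. Qed.

Lemma tsumZ U V W (t : tensor U V) (b : U -> V -> W) a :
  tsum t (fun u v => a *: b u v) = a *: tsum t b.
Proof. by rewrite /tsum scaler_sumr. Qed.

Lemma exchange_tsum U V U' V' W (t : tensor U V) (t' : tensor U' V')
    (F : U -> V -> U' -> V' -> W) :
  tsum t (fun u v => tsum t' (F u v)) =
  tsum t' (fun u' v' => tsum t (fun u v => F u v u' v')).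
Proof. exact: exchange_big. Qed.

Lemma tsum_tsum U V U' V' W (t : tensor U V) (G : U -> V -> tensor U' V')
    (b : U' -> V' -> W) : bilin b ->
  tsum (tsum t G) b = tsum t (fun u v => tsum (G u v) b).
Proof. by move=> Bb; exact: (linear_tsum (mklin (tsum_linear Bb))). Qed.

Lemma lin_id X : linear (fun x : X => x).
Proof. by []. Qed.
Lemma lin_comp X U V (f : {linear U -> V}) (g : X -> U) :
  linear g -> linear (fun x => f (g x)).
Proof. by move=> Lg a x y; rewrite Lg linearP. Qed.
Lemma lin_compf X U V (f : U -> V) (g : X -> U) :
  linear f -> linear g -> linear (fun x => f (g x)).
Proof. by move=> Lf Lg a x y; rewrite Lg Lf. Qed.
Lemma lin_ev X U V (g : X -> {linear U -> V}) u :
  linear g -> linear (fun x => g x u).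
Proof. by move=> Lg a x y; rewrite Lg. Qed.
Lemma tens_bilin U V : bilin (@tens k U V).
Proof.
split=> [v|u] a x y; apply: tensP => W b;
  rewrite (tsum_linear (bilinear_bilin b)) !tsum_tens; try exact: bilinear_bilin.
  exact: linearPl.
exact: linearPr.
Qed.
Lemma lin_tensl X U V (g : X -> U) (v : V) :
  linear g -> linear (fun x => g x ⊗ v).
Proof. by move=> Lg a x y; rewrite Lg (proj1 (tens_bilin U V)). Qed.
Lemma lin_tensr X U V (g : X -> V) (u : U) :
  linear g -> linear (fun x => u ⊗ g x).
Proof. by move=> Lg a x y; rewrite Lg (proj2 (tens_bilin U V)). Qed.
Lemma lin_bill X U V W (b : {bilinear U -> V -> W}) (g : X -> U) (v : V) :
  linear g -> linear (fun x => b (g x) v).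
Proof. by move=> Lg a x y; rewrite Lg (proj1 (bilinear_bilin b)). Qed.
Lemma lin_bilr X U V W (b : {bilinear U -> V -> W}) (g : X -> V) (u : U) :
  linear g -> linear (fun x => b u (g x)).
Proof. by move=> Lg a x y; rewrite Lg (proj2 (bilinear_bilin b)). Qed.
Lemma lin_tsum X U V W (t : tensor U V) (F : X -> U -> V -> W) :
  (forall u v, linear (fun x => F x u v)) -> linear (fun x => tsum t (F x)).
Proof.
move=> LF a x y; rewrite -tsumZ -tsumD; apply: eq_tsum => u v; exact: LF.
Qed.
Lemma lin_tsumt X U V W (g : X -> tensor U V) (F : U -> V -> W) :
  linear g -> bilin F -> linear (fun x => tsum (g x) F).
Proof. by move=> Lg /tsum_linear LF a x y; rewrite Lg LF. Qed.
Lemma lin_mull X (A : algType k) (g : X -> A) c :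
  linear g -> linear (fun x => g x * c).
Proof. by move=> Lg a x y; rewrite Lg mulrDl scalerAl. Qed.
Lemma lin_mulr X (A : algType k) (g : X -> A) c :
  linear g -> linear (fun x => c * g x).
Proof. by move=> Lg a x y; rewrite Lg mulrDr scalerAr. Qed.
Lemma lin_scalel X U V (f : {scalar U}) (g : X -> U) (v : V) :
  linear g -> linear (fun x => f (g x) *: v).
Proof. by move=> Lg a x y; rewrite Lg linearP scalerDl scalerA. Qed.
Lemma lin_scaler X V (g : X -> V) (c : k) :
  linear g -> linear (fun x => c *: g x).
Proof. by move=> Lg a x y; rewrite Lg scalerDr !scalerA mulrC. Qed.

Lemma tensor_tsum U V (t : tensor U V) : t = \tsum_(a, b <- t) (a ⊗ b) :> tensor U V.
Proof.
apply: tensP => W b; rewrite tsum_tsum; last exact: bilinear_bilin.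
by apply: eq_tsum => u v; rewrite tsum_tens//; exact: bilinear_bilin.
Qed.

Lemma tensor_lin_ext U V W (f g : tensor U V -> W) : linear f -> linear g ->
  (forall u v, f (u ⊗ v) = g (u ⊗ v)) -> f =1 g.
Proof.
move=> Lf Lg e t; rewrite (tensor_tsum t) !linf_tsum//.
by apply: eq_tsum => u v.
Qed.

End TensorTheory2.

Ltac lin_step :=
  cbv beta;
  match goal with
  | |- bilin _ => split=> ?
  | |- forall _, _ => move=> ?
  | |- _ /\ _ => split
  | |- GRing.linear_for _ (fun x => x) => apply: lin_id
  | BF : bilin ?F |- GRing.linear_for _ (fun x => ?F (@?g x) ?v) =>
      apply: (@lin_compf _ _ _ _ (fun u => F u v) g (proj1 BF v))
  | BF : bilin ?F |- GRing.linear_for _ (fun x => ?F ?u (@?g x)) =>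
      apply: (@lin_compf _ _ _ _ (F u) g (proj2 BF u))
  | LF : GRing.linear_for _ ?F |- GRing.linear_for _ (fun x => ?F (@?g x)) =>
      apply: (@lin_compf _ _ _ _ F g LF)
  | |- GRing.linear_for _ (fun x => tens (@?g x) ?v) => apply: (@lin_tensl _ _ _ _ g v)
  | |- GRing.linear_for _ (fun x => tens ?u (@?g x)) => apply: (@lin_tensr _ _ _ _ g u)
  | |- GRing.linear_for _ (tens _) => apply: (proj2 (tens_bilin _ _))
  | |- GRing.linear_for _ (fun x => tsum ?t (@?F x)) => apply: (@lin_tsum _ _ _ _ _ t F)
  | |- GRing.linear_for _ (fun x => tsum (@?g x) ?F) => apply: (@lin_tsumt _ _ _ _ _ g F)
  | |- GRing.linear_for _ (fun x => @GRing.mul _ (@?g x) ?c) => apply: (@lin_mull _ _ _ g c)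
  | |- GRing.linear_for _ (fun x => @GRing.mul _ ?c (@?g x)) => apply: (@lin_mulr _ _ _ g c)
  | |- GRing.linear_for _ (fun x => @GRing.scale _ _ (GRing.Linear.sort ?f (@?g x)) ?v) => apply: (@lin_scalel _ _ _ _ f g v)
  | |- GRing.linear_for _ (fun x => @GRing.scale _ _ ?c (@?g x)) => apply: (@lin_scaler _ _ _ g c)
  | |- GRing.linear_for _ (fun x => Bilinear.sort ?b (@?g x) ?v) => apply: (@lin_bill _ _ _ _ _ b g v)
  | |- GRing.linear_for _ (fun x => Bilinear.sort ?b ?u (@?g x)) => apply: (@lin_bilr _ _ _ _ _ b g u)
  | |- GRing.linear_for _ (fun x => GRing.Linear.sort ?f (@?g x)) => apply: (@lin_comp _ _ _ _ f g)
  | |- GRing.linear_for _ (fun x => GRing.Linear.sort (@?g x) ?u) => apply: (@lin_ev _ _ _ _ g u)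
  | |- GRing.linear_for _ _ => first [assumption | exact: linearP]
  end.
Ltac lin := repeat lin_step.

Record hopf (k : fieldType) (H : algType k) := Hopf {
  comul : {linear H -> tensor H H};
  counit : {scalar H};
  antipode : {linear H -> H};
  comulA : forall h,
    \tsum_(a, b <- comul h) \tsum_(a1, a2 <- comul a) (a1 ⊗ (a2 ⊗ b)) =
    \tsum_(a, b <- comul h) \tsum_(b1, b2 <- comul b) (a ⊗ (b1 ⊗ b2));
  counitl : forall h, \tsum_(a, b <- comul h) (counit a *: b) = h;
  counitr : forall h, \tsum_(a, b <- comul h) (counit b *: a) = h;
  comul1 : comul 1 = 1 ⊗ 1;
  comulM : forall g h, comul (g * h) =
    \tsum_(g1, g2 <- comul g) \tsum_(h1, h2 <- comul h) (g1 * h1 ⊗ g2 * h2);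
  counit1 : counit 1 = 1;
  counitM : forall g h, counit (g * h) = counit g * counit h;
  antipodel : forall h,
    \tsum_(a, b <- comul h) (antipode a * b) = counit h *: 1;
  antipoder : forall h,
    \tsum_(a, b <- comul h) (a * antipode b) = counit h *: 1 }.

Section HopfTheory.
Variables (k : fieldType) (H : algType k) (A : hopf H).
Implicit Types (M N W : lmodType k) (g h x : H).
Local Notation Δ := (comul A).
Local Notation ε := (counit A).
Local Notation S := (antipode A).

Definition trilin W (F : H -> H -> H -> W) : Prop :=
  [/\ forall b c, linear (fun a => F a b c),
      forall a c, linear (fun b => F a b c)
    & forall a b, linear (fun c => F a b c)].

Lemma swA W h (F : H -> H -> H -> W) : trilin F ->
  \tsum_(a, b <- Δ h) \tsum_(a1, a2 <- Δ a) F a1 a2 b =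
  \tsum_(a, b <- Δ h) \tsum_(b1, b2 <- Δ b) F a b1 b2.
Proof.
move=> [F1 F2 F3].
have B2 a : bilin (F a) by split.
have B : bilin (fun a t => tsum t (F a)).
  by split=> [t|a]; [apply: lin_tsum => u v; exact: F1|exact: tsum_linear].
have := congr1 (fun t => tsum t (fun a s => tsum s (F a))) (comulA A h).
rewrite !tsum_tsum// => E; move: E.
have -> : tsum (Δ h) (fun a b => tsum (tsum (Δ a) (fun a1 a2 => a1 ⊗ (a2 ⊗ b)))
   (fun a s => tsum s (F a))) =
   \tsum_(a, b <- Δ h) \tsum_(a1, a2 <- Δ a) F a1 a2 b.
  apply: eq_tsum => a b; rewrite tsum_tsum//; apply: eq_tsum => a1 a2.
  by rewrite !tsum_tens.
move=> ->; apply: eq_tsum => a b; rewrite tsum_tsum//; apply: eq_tsum => b1 b2.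
by rewrite !tsum_tens.
Qed.

Lemma sw_counitl W h (F : H -> W) : linear F ->
  \tsum_(a, b <- Δ h) (ε a *: F b) = F h.
Proof.
move=> LF; rewrite -{2}(counitl A h) linf_tsum//.
by apply: eq_tsum => a b; rewrite (scalable_linear LF).
Qed.
Lemma sw_counitr W h (F : H -> W) : linear F ->
  \tsum_(a, b <- Δ h) (ε b *: F a) = F h.
Proof.
move=> LF; rewrite -{2}(counitr A h) linf_tsum//.
by apply: eq_tsum => a b; rewrite (scalable_linear LF).
Qed.
Lemma sw_antil W h (F : H -> W) : linear F ->
  \tsum_(a, b <- Δ h) F (S a * b) = ε h *: F 1.
Proof.
move=> LF; rewrite -(linf_tsum (Δ h) (fun a b => S a * b) LF) antipodel.
exact: (scalable_linear LF).
Qed.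
Lemma sw_antir W h (F : H -> W) : linear F ->
  \tsum_(a, b <- Δ h) F (a * S b) = ε h *: F 1.
Proof.
move=> LF; rewrite -(linf_tsum (Δ h) (fun a b => a * S b) LF) antipoder.
exact: (scalable_linear LF).
Qed.
Lemma swM W g h (F : H -> H -> W) : bilin F ->
  tsum (Δ (g * h)) F =
  \tsum_(g1, g2 <- Δ g) \tsum_(h1, h2 <- Δ h) F (g1 * h1) (g2 * h2).
Proof.
move=> BF; rewrite comulM tsum_tsum//; apply: eq_tsum => g1 g2.
by rewrite tsum_tsum//; apply: eq_tsum => h1 h2; rewrite tsum_tens.
Qed.

Lemma sw_cancelr W h (F : H -> H -> W) : bilin F ->
  \tsum_(a, w <- Δ h) \tsum_(b, c <- Δ w) F (a * S b) c = F 1 h.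
Proof.
move=> BF; rewrite -(swA _ (F := fun a b c => F (a * S b) c)); last by split; lin.
under eq_tsum => a b do rewrite (sw_antir _ (proj1 BF b)).
exact: (sw_counitl _ (proj2 BF _)).
Qed.
Lemma antipode1 : S 1 = 1.
Proof.
have := antipodel A 1; rewrite comul1 tsum_tens; last by lin.
by rewrite mulr1 counit1 scale1r.
Qed.

Lemma antipodeM g h : S (g * h) = S h * S g.
Proof.
pose P (g1 g2 g3 h1 h2 h3 : H) : H := S (g1 * h1) * (g2 * h2 * (S h3 * S g3)).
transitivity (\tsum_(g1, g' <- Δ g) \tsum_(g2, g3 <- Δ g')
  \tsum_(h1, h' <- Δ h) \tsum_(h2, h3 <- Δ h') P g1 g2 g3 h1 h2 h3).
  under eq_tsum => g1 g'.
    under eq_tsum => g2 g3.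
      under eq_tsum => h1 h'.
        under eq_tsum => h2 h3 do rewrite /P -(mulrA g2) (mulrA h2).
        rewrite (sw_antir _ (F := fun e => S (g1 * h1) * (g2 * (e * S g3))));
          last by lin.
        rewrite mul1r; over.
      rewrite (sw_counitr _ (F := fun e => S (g1 * e) * (g2 * S g3)));
        last by lin.
      over.
    rewrite (sw_antir _ (F := fun e => S (g1 * h) * e)); last by lin.
    over.
  rewrite (sw_counitr _ (F := fun e => S (e * h) * 1)); last by lin.
  by rewrite mulr1.
rewrite -(swA _ (F := fun g1 g2 g3 => \tsum_(h1, h' <- Δ h)
  \tsum_(h2, h3 <- Δ h') P g1 g2 g3 h1 h2 h3)); last by split; rewrite /P; lin.
under eq_tsum => a g3.
  under eq_tsum => g1 g2.
    rewrite -(swA _ (F := P g1 g2 g3)); last by split; rewrite /P; lin.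
    over.
  rewrite exchange_tsum.
  under eq_tsum => b h3.
    rewrite -(swM a b (F := fun x y => S x * (y * (S h3 * S g3)))); last by lin.
    under eq_tsum => x y do rewrite mulrA.
    rewrite (sw_antil _ (F := fun e => e * (S h3 * S g3))); last by lin.
    rewrite mul1r counitM -scalerA; over.
  rewrite (tsumZ (Δ h) (fun b h3 => ε b *: (S h3 * S g3))) (sw_counitl _ (F := fun e => S e * S g3)); last by lin.
  over.
by rewrite (sw_counitl _ (F := fun e => S h * S e)); last by lin.
Qed.

Fact tmul_bilin : bilin (fun t s : tensor H H =>
  \tsum_(a, b <- t) \tsum_(c, d <- s) (a * c ⊗ b * d)).
Proof. by lin. Qed.
Definition tmul := mkbilin tmul_bilin.

Lemma tmul_tens a b c d : tmul (a ⊗ b) (c ⊗ d) = a * c ⊗ b * d.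
Proof. by rewrite /tmul /= tsum_tens ?tsum_tens//; lin. Qed.

Lemma tmulA : associative tmul.
Proof.
move=> t s r; move: t; apply: tensor_lin_ext; [by lin|by lin|move=> a b].
move: s; apply: tensor_lin_ext; [by lin|by lin|move=> c d].
move: r; apply: tensor_lin_ext; [by lin|by lin|move=> e f].
by rewrite !tmul_tens !mulrA.
Qed.
Lemma tmul1l : left_id (1 ⊗ 1) tmul.
Proof.
apply: tensor_lin_ext; [by lin|by lin|move=> a b].
by rewrite tmul_tens !mul1r.
Qed.
Lemma tmul1r : right_id (1 ⊗ 1) tmul.
Proof.
apply: tensor_lin_ext; [by lin|by lin|move=> a b].
by rewrite tmul_tens !mulr1.
Qed.

Lemma comul_tmul g h : Δ (g * h) = tmul (Δ g) (Δ h).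
Proof. exact: comulM. Qed.

Lemma comul_antipode h : Δ (S h) = \tsum_(a, b <- Δ h) (S b ⊗ S a).
Proof.
pose R (x : H) : tensor H H := \tsum_(a, b <- Δ x) (S b ⊗ S a).
have LR : linear R by rewrite /R; lin.
have RE x : \tsum_(a, b <- Δ x) tmul (Δ a) (R b) = ε x *: (1 ⊗ 1).
  transitivity (\tsum_(a, b <- Δ x) \tsum_(a1, a2 <- Δ a)
      \tsum_(b1, b2 <- Δ b) (a1 * S b2 ⊗ a2 * S b1)).
    apply: eq_tsum => a b; rewrite /tmul /= /R.
    apply: eq_tsum => a1 a2; rewrite tsum_tsum; last by lin.
    by apply: eq_tsum => b1 b2; rewrite tsum_tens//; lin.
  rewrite (swA _ (F := fun a1 a2 b => \tsum_(b1, b2 <- Δ b)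
    (a1 * S b2 ⊗ a2 * S b1))); last by split; lin.
  under eq_tsum => a w.
    rewrite (sw_cancelr _ (F := fun e c => a * S c ⊗ e)); last by lin.
    over.
  by rewrite (sw_antir _ (F := fun e => e ⊗ (1 : H))); last by lin.
transitivity (\tsum_(a, w <- Δ h) \tsum_(b, c <- Δ w)
   tmul (Δ (S a)) (tmul (Δ b) (R c))).
  under eq_tsum => a w.
    rewrite -(linf_tsum (Δ w) (fun b c => tmul (Δ b) (R c))
      (f := fun z => tmul (Δ (S a)) z)); last by lin.
    rewrite RE linearZr tmul1r; over.
  by rewrite (sw_counitr _ (F := fun e => Δ (S e))); last by lin.
rewrite -(swA _ (F := fun a b c => tmul (Δ (S a)) (tmul (Δ b) (R c)))); last by split; lin.
under eq_tsum => d c.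
  under eq_tsum => a b do rewrite tmulA -comul_tmul.
  rewrite (sw_antil _ (F := fun e => tmul (Δ e) (R c))); last by lin.
  rewrite comul1 tmul1l; over.
exact: (sw_counitl _ LR).
Qed.

Lemma sw_antipode W h (F : H -> H -> W) : bilin F ->
  tsum (Δ (S h)) F = \tsum_(a, b <- Δ h) F (S b) (S a).
Proof.
move=> BF; rewrite comul_antipode tsum_tsum//; apply: eq_tsum => a b.
exact: tsum_tens.
Qed.

End HopfTheory.

Record category := Category {
  obj :> Type;
  mor : obj -> obj -> Type;
  idm : forall X, mor X X;
  compm : forall X Y Z, mor Y Z -> mor X Y -> mor X Z;
  compmA : forall X Y Z T (f : mor Z T) (g : mor Y Z) (h : mor X Y),
    compm f (compm g h) = compm (compm f g) h;
  comp1m : forall X Y (f : mor X Y), compm (idm Y) f = f;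
  compm1 : forall X Y (f : mor X Y), compm f (idm X) = f }.
Arguments idm {_} _.

Record functor (C D : category) := Functor {
  fobj :> C -> D;
  fmor : forall X Y : C, mor X Y -> mor (fobj X) (fobj Y);
  fmor1 : forall X, fmor (idm X) = idm (fobj X);
  fmorM : forall (X Y Z : C) (f : mor Y Z) (g : mor X Y),
    fmor (compm f g) = compm (fmor f) (fmor g) }.
Arguments fmor {C D} _ {X Y} _.

Definition idF (C : category) : functor C C :=
  @Functor C C id (fun X Y f => f) (fun X => erefl) (fun X Y Z f g => erefl).

Section CompFunctor.
Variables (C D E : category) (G : functor D E) (F : functor C D).
Fact compF1 X : fmor G (fmor F (idm X)) = idm (G (F X)).
Proof. by rewrite !fmor1. Qed.
Fact compFM (X Y Z : C) (f : mor Y Z) (g : mor X Y) :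
  fmor G (fmor F (compm f g)) = compm (fmor G (fmor F f)) (fmor G (fmor F g)).
Proof. by rewrite !fmorM. Qed.
Definition compF : functor C E :=
  @Functor C E (fun X => G (F X)) (fun X Y f => fmor G (fmor F f)) compF1 compFM.
End CompFunctor.

Definition is_iso (C : category) (X Y : C) (f : mor X Y) : Prop :=
  exists g : mor Y X, compm g f = idm X /\ compm f g = idm Y.

Definition nat_iso (C D : category) (F G : functor C D) : Prop :=
  exists t : forall X : C, mor (F X) (G X),
    (forall X, is_iso (t X)) /\
    (forall (X Y : C) (f : mor X Y),
       compm (t Y) (fmor F f) = compm (fmor G f) (t X)).

Definition is_equivalence (C D : category) (F : functor C D) : Prop :=
  exists G : functor D C, nat_iso (idF C) (compF G F) /\ nat_iso (compF F G) (idF D).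

Section Comodules.
Variables (k : fieldType) (H : algType k) (A : hopf H).
Local Notation Δ := (comul A).
Local Notation ε := (counit A).
Local Notation S := (antipode A).

Record comodule := Comodule {
  comod_sort :> lmodType k;
  coact : {linear comod_sort -> tensor comod_sort H};
  coactA : forall m,
    \tsum_(m0, m1 <- coact m) \tsum_(m00, m01 <- coact m0) (m00 ⊗ (m01 ⊗ m1)) =
    \tsum_(m0, m1 <- coact m) \tsum_(a, b <- Δ m1) (m0 ⊗ (a ⊗ b));
  coact_counit : forall m, \tsum_(m0, m1 <- coact m) (ε m1 *: m0) = m }.

Arguments coact {_}.

Definition regular : comodule := Comodule (comulA A) (counitr A).

Section ComodHom.
Variables (M N : comodule).

Definition colinear : {pred {linear M -> N}} := fun f =>
  `[< forall m, coact (f m) = \tsum_(m0, m1 <- coact m) (f m0 ⊗ m1) >].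

Record comodHom := ComodHom {
  comod_fun :> {linear M -> N};
  _ : comod_fun \in colinear }.

Lemma comodHomP (f : comodHom) m :
  coact (f m) = \tsum_(m0, m1 <- coact m) (f m0 ⊗ m1).
Proof. by case: f => f /= /asboolP. Qed.

HB.instance Definition _ := [isSub for comod_fun].
HB.instance Definition _ := [Choice of comodHom by <:].

Fact colinear_submod : submod_closed colinear.
Proof.
split=> [|a f g /asboolP Hf /asboolP Hg]; apply/asboolP => m /=.
  rewrite linear0; apply/esym/big1 => p _.
  exact: (linear0 (mklin (proj1 (tens_bilin N H) p.2))).
rewrite linearP Hf Hg -tsumZ -tsumD; apply: eq_tsum => u v.
by rewrite (proj1 (tens_bilin N H)).
Qed.
HB.instance Definition _ :=
  GRing.isSubmodClosed.Build k {linear M -> N} colinear colinear_submod.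
HB.instance Definition _ := [SubChoice_isSubLmodule of comodHom by <:].

Lemma comodHom_ext (f g : comodHom) : (forall m, f m = g m) -> f = g.
Proof. by move=> e; apply: val_inj; exact: linear_ext. Qed.

Lemma comodHomPE a (f g : comodHom) m : (a *: f + g) m = a *: f m + g m.
Proof. by []. Qed.

Lemma lin_comodHom (X : lmodType k) (g : X -> comodHom) m :
  linear g -> linear (fun x => g x m).
Proof. by move=> Lg a x y; rewrite Lg. Qed.

End ComodHom.

Fact comod_id_subproof (M : comodule) : (idfun : {linear M -> M}) \in @colinear M M.
Proof. by apply/asboolP => m /=; rewrite -tensor_tsum. Qed.
Definition comod_id M := ComodHom (comod_id_subproof M).

Fact comod_comp_subproof (M N P : comodule) (f : comodHom N P) (g : comodHom M N) :
  (f \o g : {linear M -> P}) \in @colinear M P.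
Proof.
apply/asboolP => m /=; rewrite !comodHomP tsum_tsum; last by lin.
by apply: eq_tsum => u v; rewrite tsum_tens//; lin.
Qed.
Definition comod_comp M N P f g := ComodHom (@comod_comp_subproof M N P f g).

Definition comod_cat : category.
Proof.
by refine (@Category comodule comodHom comod_id comod_comp _ _ _) => *;
  exact: comodHom_ext.
Defined.

(* curry f is u |-> (v |-> f (u ⊗ v)). *)
Section Currying.
Variables (U V W : lmodType k) (f : {linear tensor U V -> W}).
Fact curry_subproof1 u : linear (fun v => f (u ⊗ v)).
Proof. by lin. Qed.
Fact curry_subproof2 : linear (fun u => mklin (curry_subproof1 u)).
Proof.
move=> a x y; apply: linear_ext => v /=.
by rewrite (proj1 (tens_bilin U V)) linearP.
Qed.
Definition curry : {linear U -> {linear V -> W}} := mklin curry_subproof2.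
End Currying.

Fact cscale_subproof (N : lmodType k) (n : N) : linear (fun h => ε h *: n).
Proof. by lin. Qed.
Definition cscale N n := mklin (@cscale_subproof N n).

Record contramodule := Contramodule {
  contra_sort :> lmodType k;
  contract : {linear {linear H -> contra_sort} -> contra_sort};
  contractA : forall f : {linear tensor H H -> contra_sort},
    contract (contract \o curry f) = contract (f \o Δ);
  contract_counit : forall n : contra_sort, contract (cscale n) = n }.

Arguments contract {_}.

Record contraHom (M N : contramodule) := ContraHom {
  contra_fun :> {linear M -> N};
  contraHomP : forall f : {linear H -> M},
    contra_fun (contract f) = contract (contra_fun \o f) }.

Lemma contraHom_ext M N (f g : contraHom M N) : (forall m, f m = g m) -> f = g.
Proof.
case: f g => [f Hf] [g Hg] /= /linear_ext efg; case: _ / efg in Hg *.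
by congr ContraHom; exact: Prop_irrelevance.
Qed.

Fact contra_id_subproof (M : contramodule) (f : {linear H -> M}) :
  (idfun : {linear M -> M}) (contract f) = contract (idfun \o f : {linear H -> M}).
Proof. by rewrite /=; congr (contract _); exact: linear_ext. Qed.
Definition contra_id M := ContraHom (@contra_id_subproof M).

Fact contra_comp_subproof (M N P : contramodule) (f : contraHom N P)
    (g : contraHom M N) (u : {linear H -> M}) :
  (f \o g : {linear M -> P}) (contract u) =
  contract ((f \o g) \o u : {linear H -> P}).
Proof. by rewrite /= !contraHomP; congr (contract _); exact: linear_ext. Qed.
Definition contra_comp M N P f g := ContraHom (@contra_comp_subproof M N P f g).

Definition contra_cat : category.
Proof.
by refine (@Category contramodule contraHom contra_id contra_comp _ _ _) => *;
  exact: contraHom_ext.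
Defined.

End Comodules.
Arguments coact {k H A _}.
Arguments contract {k H A _}.

Section Hat.
Variables (k : fieldType) (H : algType k) (A : hopf H).
Local Notation Δ := (comul A).
Local Notation ε := (counit A).
Local Notation S := (antipode A).

(* Hom(H, M)^H, where H coacts on itself by comultiplication. *)
Definition hat_sort (M : comodule A) : lmodType k := comodHom (regular A) M.

Section HatObject.
Variable M : comodule A.

Lemma hatP (φ : hat_sort M) (h : H) :
  coact (φ h) = \tsum_(a, b <- Δ h) (φ a ⊗ b).
Proof. exact: (comodHomP φ h). Qed.

Fact hat_contract_fun_subproof (θ : {linear H -> hat_sort M}) :
  linear (fun h => \tsum_(h1, h2 <- Δ h) θ h1 h2).
Proof.
apply: lin_tsumt; first by lin.
by split=> [b|a]; [apply: lin_comodHom; lin|lin].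
Qed.
Definition hat_contract_fun θ := mklin (hat_contract_fun_subproof θ).

Fact hat_contract_colinear (θ : {linear H -> hat_sort M}) :
  (hat_contract_fun θ : {linear regular A -> M}) \in @colinear _ _ A (regular A) M.
Proof.
have Lθ x : linear (fun a => θ a x) by apply: lin_comodHom; lin.
apply/asboolP => h /=; rewrite linear_tsum.
under eq_tsum => a b do rewrite hatP.
rewrite -(swA A _ (F := fun a b c => θ a b ⊗ c)); last first.
  by split=> *; [apply: lin_tensl; exact: Lθ|lin|lin].
apply: eq_tsum => a b.
by rewrite (linf_tsum _ _ (f := fun x => x ⊗ b))//; lin.
Qed.
Definition hat_contract_raw θ : hat_sort M := ComodHom (hat_contract_colinear θ).

Fact hat_contract_linear : linear hat_contract_raw.
Proof.
move=> a θ θ'; apply: comodHom_ext => h; rewrite comodHomPE /=.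
by rewrite -tsumZ -tsumD.
Qed.
Definition hat_contract : {linear {linear H -> hat_sort M} -> hat_sort M} :=
  mklin hat_contract_linear.

Fact hat_contractA (f : {linear tensor H H -> hat_sort M}) :
  hat_contract (hat_contract \o curry f) = hat_contract (f \o Δ).
Proof.
apply: comodHom_ext => h /=.
have Lf x : linear (fun t => f t x) by apply: lin_comodHom; lin.
rewrite -(swA A _ (F := fun a b c => f (a ⊗ b) c)); last first.
  by split=> *; [apply: (lin_compf (Lf _)); lin|apply: (lin_compf (Lf _)); lin|lin].
apply: eq_tsum => a b; rewrite [in RHS](tensor_tsum (Δ a)).
by rewrite (linf_tsum _ _ (Lf b)).
Qed.

Fact hat_contract_counit (n : hat_sort M) : hat_contract (cscale A n) = n.
Proof.
apply: comodHom_ext => h /=.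
by rewrite -[RHS](sw_counitl A h (F := n)); last by lin.
Qed.

Definition hat : contramodule A :=
  Contramodule hat_contractA hat_contract_counit.
End HatObject.

Section HatMorphism.
Variables (M N : comodule A) (f : comodHom M N).

Fact hat_map_linear :
  linear (fun φ : hat M => comod_comp f φ : hat N).
Proof. by move=> a φ ψ; apply: comodHom_ext => h /=; rewrite linearP. Qed.
Definition hat_map : {linear hat M -> hat N} := mklin hat_map_linear.

Fact hat_map_contract (θ : {linear H -> hat M}) :
  hat_map (contract θ) = contract (hat_map \o θ).
Proof. by apply: comodHom_ext => h /=; rewrite linear_tsum. Qed.
Definition hat_mor : contraHom (hat M) (hat N) := ContraHom hat_map_contract.
End HatMorphism.

Definition hat_functor : functor (comod_cat A) (contra_cat A).
Proof.
by refine (@Functor (comod_cat A) (contra_cat A) hat hat_mor _ _) => *;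
  apply: contraHom_ext => φ; apply: comodHom_ext.
Defined.

Record is_action (M : lmodType k) (act : {bilinear H -> M -> M}) : Prop :=
  IsAction {
    act1 : forall m, act 1 m = m;
    actM : forall g h m, act (g * h) m = act g (act h m) }.

Definition sw3 (W : lmodType k) (h : H) (F : H -> H -> H -> W) : W :=
  \tsum_(h1, h' <- Δ h) \tsum_(h2, h3 <- Δ h') F h1 h2 h3.

Record aydModule := AydModule {
  ayd_comod :> comodule A;
  ayd_act : {bilinear H -> ayd_comod -> ayd_comod};
  ayd_actP : is_action ayd_act;
  ayd_compat : forall h m, coact (ayd_act h m) =
    sw3 h (fun h1 h2 h3 =>
      \tsum_(m0, m1 <- coact m) (ayd_act h2 m0 ⊗ h3 * m1 * S h1)) }.

Record aydHom (M N : aydModule) := AydHom {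
  ayd_fun :> comodHom M N;
  aydHomP : forall h m, ayd_fun (ayd_act M h m) = ayd_act N h (ayd_fun m) }.

Lemma aydHom_ext M N (f g : aydHom M N) : (forall m, f m = g m) -> f = g.
Proof.
case: f g => [f Hf] [g Hg] /= /comodHom_ext efg; case: _ / efg in Hg *.
by congr AydHom; exact: Prop_irrelevance.
Qed.

Definition ayd_id M : aydHom M M :=
  @AydHom M M (comod_id M) (fun h m => erefl).

Fact ayd_comp_subproof (M N P : aydModule) (f : aydHom N P) (g : aydHom M N) h m :
  comod_comp f g (ayd_act M h m) = ayd_act P h (comod_comp f g m).
Proof. by rewrite /= !aydHomP. Qed.
Definition ayd_comp M N P f g := AydHom (@ayd_comp_subproof M N P f g).

Definition ayd_cat : category.
Proof.
by refine (@Category aydModule aydHom ayd_id ayd_comp _ _ _) => *;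
  exact: aydHom_ext.
Defined.

(* twist h f is the map h^2 f(S(h^3) - h^1). *)
Section Twist.
Variables (N : lmodType k) (act : {bilinear H -> N -> N}).
Fact twist_subproof (h : H) (f : {linear H -> N}) :
  linear (fun x => sw3 h (fun h1 h2 h3 => act h2 (f (S h3 * x * h1)))).
Proof. by rewrite /sw3; lin. Qed.
Definition twist h f : {linear H -> N} := mklin (twist_subproof h f).
End Twist.

Record aydContramodule := AydContramodule {
  aydc_contra :> contramodule A;
  aydc_act : {bilinear H -> aydc_contra -> aydc_contra};
  aydc_actP : is_action aydc_act;
  aydc_compat : forall h (f : {linear H -> aydc_contra}),
    aydc_act h (contract f) = contract (twist aydc_act h f) }.

Record aydcHom (M N : aydContramodule) := AydcHom {
  aydc_fun :> contraHom M N;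
  aydcHomP : forall h m, aydc_fun (aydc_act M h m) = aydc_act N h (aydc_fun m) }.

Lemma aydcHom_ext M N (f g : aydcHom M N) : (forall m, f m = g m) -> f = g.
Proof.
case: f g => [f Hf] [g Hg] /= /contraHom_ext efg; case: _ / efg in Hg *.
by congr AydcHom; exact: Prop_irrelevance.
Qed.

Definition aydc_id M : aydcHom M M :=
  @AydcHom M M (contra_id M) (fun h m => erefl).

Fact aydc_comp_subproof (M N P : aydContramodule) (f : aydcHom N P)
    (g : aydcHom M N) h m :
  contra_comp f g (aydc_act M h m) = aydc_act P h (contra_comp f g m).
Proof. by rewrite /= !aydcHomP. Qed.
Definition aydc_comp M N P f g := AydcHom (@aydc_comp_subproof M N P f g).

Definition aydc_cat : category.
Proof.
by refine (@Category aydContramodule aydcHom aydc_id aydc_comp _ _ _) => *;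
  exact: aydcHom_ext.
Defined.

Section HatAydObject.
Variable M : aydModule.
Local Notation act := (ayd_act M).

Lemma sw_triple (W : lmodType k) (u x v : H) (G : H -> H -> W) : bilin G ->
  tsum (Δ (S u * x * v)) G =
  \tsum_(u1, u2 <- Δ u) \tsum_(x1, x2 <- Δ x) \tsum_(v1, v2 <- Δ v)
    G (S u2 * x1 * v1) (S u1 * x2 * v2).
Proof.
move=> BG; rewrite swM// swM; last by lin.
by rewrite sw_antipode//; lin.
Qed.

Fact hat_act_colinear (h : H) (φ : hat M) :
  (twist act h φ : {linear regular A -> M}) \in @colinear _ _ A (regular A) M.
Proof.
have Lφ : linear (φ : H -> M) by lin.
apply/asboolP => x /=.
rewrite /sw3.
transitivity (\tsum_(x1, x2 <- Δ x) \tsum_(s, w' <- Δ h) \tsum_(q, w4 <- Δ w')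
   (act q (φ (S w4 * x1 * s)) ⊗ x2)); last first.
  apply: eq_tsum => x1 x2; rewrite [RHS](linf_tsum _ _ (f := fun y => y ⊗ x2)); last by lin.
  apply: eq_tsum => s w'; rewrite [RHS](linf_tsum _ _ (f := fun y => y ⊗ x2)) //; lin.
pose F x1 x2 s t p q r u v : tensor M H :=
  act q (φ (S v * x1 * s)) ⊗ (r * (S u * x2 * t) * S p).
transitivity (\tsum_(x1, x2 <- Δ x) \tsum_(h1, w <- Δ h)
  \tsum_(s, t <- Δ h1) \tsum_(h2, h3 <- Δ w) \tsum_(p, w2 <- Δ h2) \tsum_(q, r <- Δ w2)
  \tsum_(u, v <- Δ h3) F x1 x2 s t p q r u v).
  rewrite linear_tsum exchange_tsum; apply: eq_tsum => h1 w.
  rewrite linear_tsum.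
  under [RHS]eq_tsum => x1 x2 do rewrite exchange_tsum.
  rewrite [RHS]exchange_tsum; apply: eq_tsum => h2 h3.
  rewrite ayd_compat /sw3.
  under [RHS]eq_tsum => x1 x2 do rewrite exchange_tsum.
  rewrite [RHS]exchange_tsum; apply: eq_tsum => p w2.
  under [RHS]eq_tsum => x1 x2 do rewrite exchange_tsum.
  rewrite [RHS]exchange_tsum; apply: eq_tsum => q r.
  rewrite hatP tsum_tsum; last by lin.
  under eq_tsum => a b.
    rewrite tsum_tens; last by lin.
    over.
  rewrite [LHS]sw_triple; last by lin.
  rewrite exchange_tsum; apply: eq_tsum => x1 x2.
  by rewrite exchange_tsum.
apply: eq_tsum => x1 x2.
rewrite (swA A _ (F := fun s t w => \tsum_(h2, h3 <- Δ w) \tsum_(p, w2 <- Δ h2)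
  \tsum_(q, r <- Δ w2) \tsum_(u, v <- Δ h3) F x1 x2 s t p q r u v)); last first.
  by split; rewrite /F; lin.
apply: eq_tsum => s w'.
under eq_tsum => t w.
  rewrite (swA A _ (F := fun p w2 h3 => \tsum_(q, r <- Δ w2) \tsum_(u, v <- Δ h3)
    F x1 x2 s t p q r u v)); last by split; rewrite /F; lin.
  over.
pose K e c : tensor M H := \tsum_(w2, h3 <- Δ c) \tsum_(q, r <- Δ w2)
  \tsum_(u, v <- Δ h3) (act q (φ (S v * x1 * s)) ⊗ (r * (S u * x2) * e)).
transitivity (\tsum_(t, w <- Δ w') \tsum_(p, w3 <- Δ w) K (t * S p) w3).
  do 5 (apply: eq_tsum => ? ?); rewrite /F; congr (_ ⊗ _).
  by rewrite !mulrA.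
rewrite (sw_cancelr A _ (F := K)) /K; last by lin.
rewrite (swA A _ (F := fun q r h3 => \tsum_(u, v <- Δ h3)
  (act q (φ (S v * x1 * s)) ⊗ (r * (S u * x2) * 1)))); last by split; lin.
apply: eq_tsum => q w4.
under eq_tsum => r h3 do under eq_tsum => u v do rewrite mulr1 mulrA.
rewrite (sw_cancelr A _ (F := fun e v => act q (φ (S v * x1 * s)) ⊗ (e * x2)));
  last by lin.
by rewrite mul1r.
Qed.

Definition hat_act_raw h (φ : hat M) : hat M := ComodHom (hat_act_colinear h φ).

Fact hat_act_bilin : bilin hat_act_raw.
Proof.
split=> [φ|h] a x y; apply: comodHom_ext => z; rewrite comodHomPE /=.
  pose G t := tsum t (fun h1 h' => \tsum_(h2, h3 <- Δ h') act h2 (φ (S h3 * z * h1))).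
  have LG : linear (fun h => G (Δ h)) by rewrite /G; lin.
  exact: LG.
rewrite /sw3 -tsumZ -tsumD; apply: eq_tsum => h1 h'.
rewrite -tsumZ -tsumD; apply: eq_tsum => h2 h3.
exact: linearPr.
Qed.
Definition hat_act : {bilinear H -> hat M -> hat M} := mkbilin hat_act_bilin.

Fact hat_actP : is_action hat_act.
Proof.
split=> [φ|g h φ]; apply: comodHom_ext => x /=; rewrite /sw3.
  rewrite comul1 tsum_tens; last by lin.
  rewrite comul1 tsum_tens; last by lin.
  by rewrite antipode1 mul1r mulr1 (act1 (ayd_actP M)).
rewrite swM; last by lin.
apply: eq_tsum => g1 g'.
transitivity (\tsum_(h1, h' <- Δ h) \tsum_(g2, g3 <- Δ g') \tsum_(h2, h3 <- Δ h')
  act (g2 * h2) (φ (S (g3 * h3) * x * (g1 * h1)))).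
  by apply: eq_tsum => h1 h'; rewrite swM//; lin.
rewrite exchange_tsum; apply: eq_tsum => g2 g3.
rewrite (linf_tsum _ _ (f := act g2)); last by lin.
apply: eq_tsum => h1 h'; rewrite (linf_tsum _ _ (f := act g2)); last by lin.
apply: eq_tsum => h2 h3.
by rewrite (actM (ayd_actP M)) antipodeM !mulrA.
Qed.

Fact hat_ayd_compat h (θ : {linear H -> hat M}) :
  hat_act h (contract θ) = contract (twist hat_act h θ).
Proof.
apply: comodHom_ext => x /=.
pose T a b : M := θ a b.
have BT : bilin T.
  by split=> [b|a]; rewrite /T; [apply: lin_comodHom; lin|lin].
pose F x1 x2 v1 v2 m u1 u2 : M := act m (T (S u2 * x1 * v1) (S u1 * x2 * v2)).
transitivity (\tsum_(x1, x2 <- Δ x) \tsum_(h1, w <- Δ h) \tsum_(v1, v2 <- Δ h1)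
  \tsum_(m, h3 <- Δ w) \tsum_(u1, u2 <- Δ h3) F x1 x2 v1 v2 m u1 u2).
  rewrite [RHS]exchange_tsum /sw3; apply: eq_tsum => h1 w.
  under [RHS]eq_tsum => x1 x2 do rewrite exchange_tsum.
  rewrite [RHS]exchange_tsum; apply: eq_tsum => m h3.
  rewrite (linf_tsum _ _ (f := act m)); last by lin.
  rewrite (sw_triple h3 x h1 (G := fun a b => act m (T a b))); last by lin.
  rewrite exchange_tsum; apply: eq_tsum => x1 x2.
  by rewrite exchange_tsum.
apply: eq_tsum => x1 x2; apply/esym.
have Lx (y : H) : linear (fun φ : hat M => φ y) by apply: lin_comodHom; lin.
rewrite /sw3 (linf_tsum _ _ (Lx x2)).
under eq_tsum => a w do rewrite (linf_tsum _ _ (Lx x2)) /=.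
rewrite (swA A _ (F := fun v1 v2 w => \tsum_(m, h3 <- Δ w)
  \tsum_(u1, u2 <- Δ h3) F x1 x2 v1 v2 m u1 u2)); last by split; rewrite /F; lin.
apply: eq_tsum => a w.
transitivity (\tsum_(b, c <- Δ w) \tsum_(b1, b' <- Δ b) \tsum_(b2, b3 <- Δ b')
  F x1 x2 a b1 b2 b3 c); first by [].
rewrite (swA A _ (F := fun b1 b' c => \tsum_(b2, b3 <- Δ b')
  F x1 x2 a b1 b2 b3 c)); last by split; rewrite /F; lin.
apply: eq_tsum => b1 w2.
by rewrite (swA A _ (F := fun b2 b3 c => F x1 x2 a b1 b2 b3 c)); last
  by split; rewrite /F; lin.
Qed.

Definition hat_ayd : aydContramodule := AydContramodule hat_actP hat_ayd_compat.
End HatAydObject.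

Fact hat_ayd_mor_subproof (M N : aydModule) (f : aydHom M N) h (φ : hat M) :
  hat_mor f (hat_act M h φ) = hat_act N h (hat_mor f φ).
Proof.
apply: comodHom_ext => x /=; rewrite /sw3 linear_tsum; apply: eq_tsum => h1 h'.
by rewrite linear_tsum; apply: eq_tsum => h2 h3; exact: aydHomP.
Qed.
Definition hat_ayd_mor M N (f : aydHom M N) : aydcHom (hat_ayd M) (hat_ayd N) :=
  @AydcHom (hat_ayd M) (hat_ayd N) (hat_mor f) (@hat_ayd_mor_subproof M N f).

Definition hat_ayd_functor : functor ayd_cat aydc_cat.
Proof.
by refine (@Functor ayd_cat aydc_cat hat_ayd hat_ayd_mor _ _) => *;
  apply: aydcHom_ext => φ; apply: comodHom_ext.
Defined.

End Hat.

(* Main.v *)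
(* Let lam be a left integral on H and L a right integral in H with
   lam (S L) = 1.  Such a lam is found among the traces, as functions of x, of
   the maps y |-> p ⇀ (x * S (S y)), where p ⇀ h = p(h2) h1, because these
   functions determine the functional p; then L exists because lam is
   nondegenerate.  The legs of Δ L are dual bases for the form lam (x * S y):
     lam (x * S L1) L2 = x   and   lam (L2 * S y) L1 = y.
   By the second identity, evaluation at L is a bijection from Hom(H, M)^H to M,
   with inverse m |-> (h |-> lam (m1 * S h) m0).  A contramodule N therefore
   becomes a comodule on the same vector space, by
   n |-> alpha (x |-> lam (L1 * S x) n) ⊗ L2, and evaluation at L is a natural
   isomorphism on both sides.  In the anti-Yetter-Drinfeld case the action on N
   is twisted into chi(h2) h1 n, where h * L = chi(h) L: this compensates the
   Nakayama automorphism of lam, lam (h * u) = lam (u * S (S (chi(h2) h1))). *)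
Require Import Defs.
From mathcomp Require Import all_boot all_algebra falgebra.
From mathcomp Require Import boolp.

Set Implicit Arguments.
Unset Strict Implicit.
Unset Printing Implicit Defensive.

Import GRing.Theory.
Local Open Scope ring_scope.

Reserved Notation "p ⇀ h" (at level 38, right associativity).
Reserved Notation "h ↼ p" (at level 39, left associativity).
Reserved Notation "f ▷ n" (at level 38, right associativity).
(* Always declared as [p h : k]: a value of a functional lies in [k^o], and
   without the cast [p h *: v] would be elaborated as a scaling over the ring
   [k^o]. *)
Reserved Notation "⟨ p , h ⟩" (format "⟨ p ,  h ⟩").

(** * Multilinear sums and dual bases *)

Section LinearSums.
Variables (k : fieldType) (U V W X : lmodType k).
Implicit Types (I : finType) (t : tensor U V).

Lemma lin_sum I (F : I -> X -> W) :
  (forall i, linear (F i)) -> linear (fun x => \sum_i F i x).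
Proof.
move=> LF a x y; rewrite scaler_sumr -big_split; apply: eq_bigr => i _.
exact: LF.
Qed.

Lemma lin_scalel_regular (g : X -> k^o) (w : W) :
  linear g -> linear (fun x => g x *: w).
Proof. by move=> Lg a x y; rewrite Lg scalerDl scalerA. Qed.

Lemma linf_sum I (f : X -> W) (F : I -> X) :
  linear f -> f (\sum_i F i) = \sum_i f (F i).
Proof. by move=> Lf; exact: (linear_sum (mklin Lf)). Qed.

Lemma linf_sumZ I (f : X -> W) (a : I -> k) (F : I -> X) :
  linear f -> f (\sum_i a i *: F i) = \sum_i a i *: f (F i).
Proof.
by move=> Lf; rewrite linf_sum//; under eq_bigr do rewrite (scalable_linear Lf).
Qed.

Lemma linf_tsumZ (f : X -> W) t (a : U -> V -> k) (F : U -> V -> X) :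
  linear f -> f (\tsum_(u, v <- t) (a u v *: F u v)) =
              \tsum_(u, v <- t) (a u v *: f (F u v)).
Proof.
move=> Lf; rewrite linf_tsum//.
by apply: eq_tsum => u v; exact: scalable_linear.
Qed.

Lemma exchange_sum_tsum I t (F : I -> U -> V -> W) :
  \sum_i tsum t (F i) = \tsum_(u, v <- t) \sum_i F i u v.
Proof. exact: exchange_big. Qed.

Lemma mulr_tsuml (B : algType k) t (F : U -> V -> B) x :
  tsum t F * x = \tsum_(u, v <- t) (F u v * x).
Proof. exact: mulr_suml. Qed.

Lemma mulr_tsumr (B : algType k) t (F : U -> V -> B) x :
  x * tsum t F = \tsum_(u, v <- t) (x * F u v).
Proof. exact: mulr_sumr. Qed.

End LinearSums.

(* Extends [lin] to finite sums and to coefficients [p x] in which the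
   functional [p] varies. *)
Ltac lin ::= repeat (cbv beta;
  match goal with
  | BF : bilin ?F |- bilin ?F => exact: BF
  | BF : bilin ?F |- GRing.linear_for _ (?F ?u) => exact: (proj2 BF u)
  | |- GRing.linear_for _ (fun x => \sum_i (@?F i x)) =>
      apply: (@lin_sum _ _ _ _ F)
  | |- GRing.linear_for _ (fun x => @GRing.scale _ _ (@?g x) ?v) =>
      apply: (@lin_scalel_regular _ _ _ g v)
  | |- _ => lin_step
  end).

Section DualBasis.
Variables (k : fieldType) (V W : lmodType k).
Variables (I : finType) (b : I -> V) (c : I -> {linear V -> k^o}).
Local Notation "⟨ p , v ⟩" := (p v : k).

Definition dual_basis : Prop := forall v, \sum_i ⟨c i, v⟩ *: b i = v.

Hypothesis bc_dual : dual_basis.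

Lemma sum_dual_basis (F : V -> W) v :
  linear F -> \sum_i ⟨c i, v⟩ *: F (b i) = F v.
Proof. by move=> LF; rewrite -{2}(bc_dual v) linf_sumZ. Qed.

Lemma sum_dual_basis_functional (F : {linear V -> k^o} -> W)
    (p : {linear V -> k^o}) :
  linear F -> \sum_i ⟨p, b i⟩ *: F (c i) = F p.
Proof.
move=> LF; rewrite -(linf_sumZ _ _ LF); congr F; apply: linear_ext => v.
rewrite (linf_sumZ _ _ (f := fun q : {linear V -> k^o} => q v)); last by lin.
rewrite -[in RHS](bc_dual v) linear_sum; apply: eq_bigr => i _.
by rewrite linearZ; exact: mulrC.
Qed.

Lemma dual_basis_ext (F G : V -> W) : linear F -> linear G ->
  (forall i, F (b i) = G (b i)) -> F =1 G.
Proof.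
move=> LF LG FG v; rewrite -(sum_dual_basis v LF) -(sum_dual_basis v LG).
by apply: eq_bigr => i _; rewrite FG.
Qed.

End DualBasis.

(** * Isomorphisms in the four categories *)

Lemma nat_iso_sym (C D : category) (F G : functor C D) :
  nat_iso F G -> nat_iso G F.
Proof.
move=> [t [/(_ _)/cid t_iso t_nat]].
exists (fun X => sval (t_iso X)); split=> [X|X Y f].
  by exists (t X); case: (svalP (t_iso X)).
have [_ tK] := svalP (t_iso X); have [Kt _] := svalP (t_iso Y).
rewrite -[LHS]compm1 -{1}tK -!compmA (compmA (fmor G f)) -t_nat.
by rewrite !compmA Kt comp1m.
Qed.

Section Isomorphisms.
Variables (k : fieldType) (H : algType k) (A : hopf H).

Lemma comodHom_inverse (M N : comodule A) (f : comodHom M N) :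
  bijective f -> exists2 g : comodHom N M, cancel f g & cancel g f.
Proof.
move=> [g fK gK]; pose g_lin := mklin (can2_linear fK gK).
have g_colinear : g_lin \in @colinear _ _ A N M.
  apply/asboolP => n; rewrite -[in RHS](gK n) comodHomP tsum_tsum; last by lin.
  rewrite [LHS]tensor_tsum; apply: eq_tsum => u v.
  rewrite tsum_tens; last by lin.
  by rewrite /= fK.
by exists (ComodHom g_colinear).
Qed.

Lemma contraHom_inverse (M N : contramodule A) (f : contraHom M N) :
  bijective f -> exists2 g : contraHom N M, cancel f g & cancel g f.
Proof.
move=> [g fK gK]; pose g_lin := mklin (can2_linear fK gK).
have g_contract (u : {linear H -> N}) :
    g_lin (contract u) = contract (g_lin \o u).
  apply: (can_inj fK); rewrite /= gK contraHomP; congr (contract _).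
  by apply: linear_ext => x /=; rewrite gK.
by exists (ContraHom g_contract).
Qed.

Lemma comodHom_is_iso (M N : comodule A) (f : comodHom M N) :
  bijective f -> @is_iso (comod_cat A) M N f.
Proof.
by case/comodHom_inverse=> g fK gK; exists g; split; apply: comodHom_ext.
Qed.

Lemma contraHom_is_iso (M N : contramodule A) (f : contraHom M N) :
  bijective f -> @is_iso (contra_cat A) M N f.
Proof.
by case/contraHom_inverse=> g fK gK; exists g; split; apply: contraHom_ext.
Qed.

Lemma aydHom_is_iso (M N : aydModule A) (f : aydHom M N) :
  bijective f -> @is_iso (ayd_cat A) M N f.
Proof.
case/comodHom_inverse=> g fK gK.
have g_act h n : g (ayd_act N h n) = ayd_act M h (g n).
  by apply: (can_inj fK); rewrite aydHomP !gK.
by exists (AydHom g_act); split; apply: aydHom_ext.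
Qed.

Lemma aydcHom_is_iso (M N : aydContramodule A) (f : aydcHom M N) :
  bijective f -> @is_iso (aydc_cat A) M N f.
Proof.
case/contraHom_inverse=> g fK gK.
have g_act h n : g (aydc_act N h n) = aydc_act M h (g n).
  by apply: (can_inj fK); rewrite aydcHomP !gK.
by exists (AydcHom g_act); split; apply: aydcHom_ext.
Qed.

End Isomorphisms.

(** * Sweedler sums and convolution *)

Section Sweedler.
Variables (k : fieldType) (H : algType k) (A : hopf H).
Implicit Types (h : H) (W : lmodType k).
Local Notation Δ := (comul A).
Local Notation ε := (counit A).
Local Notation S := (antipode A).
Local Notation sw3 := (sw3 A).

Lemma sw_cancell W h (F : H -> H -> W) : bilin F ->
  \tsum_(a, w <- Δ h) \tsum_(b, c <- Δ w) F (S a * b) c = F 1 h.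
Proof.
move=> BF; rewrite -(swA A _ (F := fun a b c => F (S a * b) c));
  last by split; lin.
under eq_tsum => a b do rewrite (sw_antil A _ (proj1 BF b)).
exact: (sw_counitl A _ (proj2 BF _)).
Qed.

Lemma counit_antipode h : ε (S h) = ε h.
Proof.
have := congr1 ε (antipoder A h).
rewrite (linear_tsum (ε : {linear H -> k^o})) linearZ /= counit1 mulr1 => <-.
under eq_tsum => a b do rewrite counitM.
by rewrite (sw_counitl A h (F := ε \o S : {linear H -> k^o})); last by lin.
Qed.

Lemma sw_coactA (M : comodule A) W (m : M) (F : M -> H -> H -> W) :
  (forall b c, linear (fun a => F a b c)) -> (forall a, bilin (F a)) ->
  \tsum_(m0, m1 <- coact m) \tsum_(m00, m01 <- coact m0) F m00 m01 m1 =
  \tsum_(m0, m1 <- coact m) \tsum_(a, b <- Δ m1) F m0 a b.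
Proof.
move=> F1 BF; pose Φ t := tsum t (fun a s => tsum s (F a)).
have B : bilin (fun a t => tsum t (F a)).
  by split=> [t|a]; [apply: lin_tsum => u v; exact: F1|exact: tsum_linear].
have LΦ : linear Φ := tsum_linear B.
have Φ_tens a b c : Φ (a ⊗ (b ⊗ c)) = F a b c by rewrite /Φ !tsum_tens.
transitivity (Φ (\tsum_(m0, m1 <- coact m)
    \tsum_(m00, m01 <- coact m0) (m00 ⊗ (m01 ⊗ m1)))).
  rewrite linf_tsum//; apply: eq_tsum => m0 m1.
  by rewrite linf_tsum//; apply: eq_tsum => m00 m01.
rewrite coactA linf_tsum//; apply: eq_tsum => m0 m1.
by rewrite linf_tsum//; apply: eq_tsum => a b.
Qed.

Lemma eq_sw3 W h (F G : H -> H -> H -> W) :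
  (forall a b c, F a b c = G a b c) -> sw3 h F = sw3 h G.
Proof. by move=> FG; do 2 apply: eq_tsum => ? ?. Qed.

Lemma linf_sw3 W W' h (f : W -> W') (F : H -> H -> H -> W) : linear f ->
  f (sw3 h F) = sw3 h (fun a b c => f (F a b c)).
Proof.
by move=> Lf; rewrite linf_tsum//; apply: eq_tsum => a b; exact: linf_tsum.
Qed.

Lemma exchange_tsum_sw3 (U V : lmodType k) W (t : tensor U V) h
    (F : U -> V -> H -> H -> H -> W) :
  tsum t (fun u v => sw3 h (F u v)) =
  sw3 h (fun a b c => \tsum_(u, v <- t) F u v a b c).
Proof.
by rewrite exchange_tsum; apply: eq_tsum => a w; exact: exchange_tsum.
Qed.

Lemma sw3_counitl W h (F : H -> H -> W) : bilin F ->
  sw3 h (fun a b c => ε a *: F b c) = tsum (Δ h) F.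
Proof.
move=> BF.
rewrite -[RHS](sw_counitl A h (F := fun x => tsum (Δ x) F)); last by lin.
by apply: eq_tsum => a w; rewrite -tsumZ.
Qed.

Lemma sw3_sw3 W h (F : H -> H -> H -> H -> H -> W) :
  (forall b c d e, linear (fun a => F a b c d e)) ->
  (forall a c d e, linear (fun b => F a b c d e)) ->
  (forall a b d e, linear (fun c => F a b c d e)) ->
  (forall a b c e, linear (fun d => F a b c d e)) ->
  (forall a b c d, linear (F a b c d)) ->
  sw3 h (fun a w e => sw3 w (fun b c d => F a b c d e)) =
  sw3 h (fun u c v => \tsum_(a, b <- Δ u) \tsum_(d, e <- Δ v) F a b c d e).
Proof.
move=> F1 F2 F3 F4 F5; have BF a b c : bilin (F a b c) by split.
pose G a b z := \tsum_(c, v <- Δ z) \tsum_(d, e <- Δ v) F a b c d e.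
transitivity (\tsum_(a, h' <- Δ h) \tsum_(b, z <- Δ h') G a b z).
  apply: eq_tsum => a h'.
  rewrite (swA A h' (F := fun b w e => \tsum_(c, d <- Δ w) F a b c d e)).
    by apply: eq_tsum => b z; apply: swA; split.
  by split=> *; lin; auto.
rewrite -(swA A h (F := G)); last by split=> *; rewrite /G; lin; auto.
by apply: eq_tsum => u z; rewrite exchange_tsum.
Qed.

End Sweedler.

Section Convolution.
Variables (k : fieldType) (H : algType k) (A : hopf H).
Implicit Types (h x : H) (p q r : {linear H -> k^o}) (W : lmodType k).
Local Notation Δ := (comul A).
Local Notation ε := (counit A).
Local Notation S := (antipode A).
Local Notation "⟨ p , h ⟩" := (p h : k).

Fact lhit_bilin : bilin (fun p h => \tsum_(h1, h2 <- Δ h) (⟨p, h2⟩ *: h1)).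
Proof. by lin. Qed.
(* [/=] would unfold this map, and the later ones of its kind, if it were not
   locked. *)
Definition lhit : {bilinear {linear H -> k^o} -> H -> H} :=
  locked (mkbilin lhit_bilin).
Local Notation "p ⇀ h" := (lhit p h).

Fact rhit_bilin : bilin (fun h p => \tsum_(h1, h2 <- Δ h) (⟨p, h1⟩ *: h2)).
Proof. by lin. Qed.
Definition rhit : {bilinear H -> {linear H -> k^o} -> H} :=
  locked (mkbilin rhit_bilin).
Local Notation "h ↼ p" := (rhit h p).

Lemma lhitE p h : p ⇀ h = \tsum_(h1, h2 <- Δ h) (⟨p, h2⟩ *: h1).
Proof. by rewrite /lhit -lock. Qed.

Lemma rhitE h p : h ↼ p = \tsum_(h1, h2 <- Δ h) (⟨p, h1⟩ *: h2).
Proof. by rewrite /rhit -lock. Qed.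

Lemma sw_lhit W h p (F : H -> W) : linear F ->
  \tsum_(a, b <- Δ h) (⟨p, b⟩ *: F a) = F (p ⇀ h).
Proof. by move=> LF; rewrite lhitE linf_tsumZ. Qed.

Lemma sw_rhit W h p (F : H -> W) : linear F ->
  \tsum_(a, b <- Δ h) (⟨p, a⟩ *: F b) = F (h ↼ p).
Proof. by move=> LF; rewrite rhitE linf_tsumZ. Qed.

Lemma comul_lhit W h p (F : H -> H -> W) : bilin F ->
  tsum (Δ (p ⇀ h)) F = \tsum_(a, b <- Δ h) F a (p ⇀ b).
Proof.
move=> BF; rewrite -(sw_lhit _ _ (F := fun x => tsum (Δ x) F)); last by lin.
under eq_tsum => a b do rewrite -tsumZ.
rewrite (swA A _ (F := fun a b c => ⟨p, c⟩ *: F a b)); last by split; lin.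
by apply: eq_tsum => a b; rewrite sw_lhit//; lin.
Qed.

Lemma comul_rhit W h p (F : H -> H -> W) : bilin F ->
  tsum (Δ (h ↼ p)) F = \tsum_(a, b <- Δ h) F (a ↼ p) b.
Proof.
move=> BF; rewrite -(sw_rhit _ _ (F := fun x => tsum (Δ x) F)); last by lin.
under eq_tsum => a b do rewrite -tsumZ.
rewrite -(swA A _ (F := fun a b c => ⟨p, a⟩ *: F b c)); last by split; lin.
by apply: eq_tsum => a b; rewrite (sw_rhit _ _ (F := F^~ b))//; lin.
Qed.

Lemma lhit_counit h : ε ⇀ h = h.
Proof. by rewrite lhitE; exact: counitr. Qed.

Lemma rhit_counit h : h ↼ ε = h.
Proof. by rewrite rhitE; exact: counitl. Qed.

Lemma counit_lhit p h : ε (p ⇀ h) = p h.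
Proof.
rewrite -(sw_lhit _ _ (F := ε : {linear H -> k^o})); last by lin.
under eq_tsum => a b do rewrite [_ *: _]mulrC.
by rewrite (sw_counitl A h (F := p)); last by lin.
Qed.

Fact conv_bilin : bilin (fun p q => p \o lhit q : {linear H -> k^o}).
Proof.
split=> [q|p] a x y; apply: linear_ext=> h //=.
by rewrite linearPl linearP.
Qed.
Definition conv :
    {bilinear {linear H -> k^o} -> {linear H -> k^o} -> {linear H -> k^o}} :=
  locked (mkbilin conv_bilin).

Lemma convE p q h : conv p q h = p (q ⇀ h).
Proof. by rewrite /conv -lock. Qed.

Lemma tsum_scale_conv W p q h (w : W) :
  \tsum_(x, y <- Δ h) (⟨p, x⟩ *: (⟨q, y⟩ *: w)) = ⟨conv p q, h⟩ *: w.
Proof.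
rewrite convE -(sw_lhit _ _ (F := fun x => ⟨p, x⟩ *: w)); last by lin.
by apply: eq_tsum => x y; rewrite !scalerA mulrC.
Qed.

Lemma lhit_conv p q h : conv p q ⇀ h = p ⇀ q ⇀ h.
Proof.
rewrite lhitE [RHS]lhitE comul_lhit; last by lin.
by apply: eq_tsum => a b; rewrite convE.
Qed.

Lemma conv_tsum p q h :
  conv p q h = \tsum_(x, y <- Δ h) (⟨p, x⟩ *: (q y : k^o)).
Proof.
rewrite convE -(sw_lhit _ _ (F := p)); last by lin.
by apply: eq_tsum => x y; exact: mulrC.
Qed.

Lemma conv_rhit p q h : conv p q h = q (h ↼ p).
Proof. by rewrite conv_tsum sw_rhit; last by lin. Qed.

Lemma convA p q r : conv p (conv q r) = conv (conv p q) r.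
Proof. by apply: linear_ext => h; rewrite !convE lhit_conv. Qed.

Lemma conv_counitl p : conv ε p = p.
Proof. by apply: linear_ext => h; rewrite convE counit_lhit. Qed.

Lemma sw3_lhit W h p (F : H -> H -> H -> W) : trilin F ->
  sw3 A (p ⇀ h) F = sw3 A h (fun a b c => F a b (p ⇀ c)).
Proof.
move=> [F1 F2 F3]; have BF a : bilin (F a) by split.
rewrite /sw3 comul_lhit; last first.
  by split=> [t|a]; [apply: lin_tsum => b c; exact: F1|lin].
by apply: eq_tsum => a w; rewrite comul_lhit.
Qed.

Section Character.
Variable p : {linear H -> k^o}.
Hypotheses (p1 : p 1 = 1) (pM : {morph p : g h / g * h}).

Lemma lhit_char1 : p ⇀ 1 = 1.
Proof. by rewrite lhitE comul1 tsum_tens ?p1 ?scale1r//; lin. Qed.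

Lemma lhit_charM g h : p ⇀ (g * h) = (p ⇀ g) * (p ⇀ h).
Proof.
rewrite !lhitE swM ?mulr_tsuml; last by lin.
apply: eq_tsum => g1 g2; rewrite mulr_tsumr; apply: eq_tsum => h1 h2.
by rewrite pM -scalerAl -scalerAr scalerA.
Qed.

Lemma conv_char_antipode : conv p (p \o S) = ε.
Proof.
apply: linear_ext => h; rewrite conv_tsum.
transitivity (\tsum_(x, y <- Δ h) (p (x * S y) : k^o)).
  by apply: eq_tsum => x y; rewrite pM.
by rewrite (sw_antir A h (F := p)) ?p1; [exact: mulr1|lin].
Qed.

Lemma conv_antipode_char : conv (p \o S) p = ε.
Proof.
apply: linear_ext => h; rewrite conv_tsum.
transitivity (\tsum_(x, y <- Δ h) (p (S x * y) : k^o)).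
  by apply: eq_tsum => x y; rewrite pM.
by rewrite (sw_antil A h (F := p)) ?p1; [exact: mulr1|lin].
Qed.

End Character.

(* The comultiplication of the canonical element of H ⊗ H^* is computed by the
   multiplication of H^*. *)
Lemma sum_dual_basis_comul W (I : finType) (b : I -> H)
    (c : I -> {linear H -> k^o}) (G : H -> H -> {linear H -> k^o} -> W) :
  dual_basis b c ->
  (forall y p, linear (fun x => G x y p)) ->
  (forall x p, linear (fun y => G x y p)) ->
  (forall x y, linear (G x y)) ->
  \sum_i (\tsum_(x, y <- Δ (b i)) G x y (c i)) =
  \sum_i \sum_j G (b i) (b j) (conv (c i) (c j)).
Proof.
move=> bc_dual G1 G2 G3.
transitivity (\sum_l \sum_i \sum_j
    (⟨conv (c i) (c j), b l⟩ *: G (b i) (b j) (c l))).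
  apply: eq_bigr => l _.
  under eq_tsum => x y.
    rewrite -(sum_dual_basis bc_dual x (F := fun x => G x y (c l)));
      last exact: G1.
    under eq_bigr => i _.
      rewrite -(sum_dual_basis bc_dual y (F := fun y => G (b i) y (c l)));
        last exact: G2.
      over.
    over.
  rewrite -exchange_sum_tsum; apply: eq_bigr => i _.
  under eq_tsum => x y do rewrite scaler_sumr.
  rewrite -exchange_sum_tsum; apply: eq_bigr => j _.
  exact: tsum_scale_conv.
rewrite exchange_big; apply: eq_bigr => i _; rewrite exchange_big.
by apply: eq_bigr => j _; apply: sum_dual_basis_functional.
Qed.

End Convolution.

(** * The action of functionals on a contramodule *)

Section ContraAction.
Variables (k : fieldType) (H : algType k) (A : hopf H).
Implicit Types (f g : {linear H -> k^o}) (h x : H).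
Local Notation ε := (counit A).
Local Notation S := (antipode A).
Local Notation "⟨ p , h ⟩" := (p h : k).

Section Action.
Variable N : contramodule A.
Implicit Types n : N.

Fact scale_functional_subproof f n : linear (fun h => ⟨f, h⟩ *: n).
Proof. by lin. Qed.
Definition scale_functional f n : {linear H -> N} :=
  mklin (scale_functional_subproof f n).

Fact contra_act_bilin : bilin (fun f n => contract (scale_functional f n)).
Proof.
split=> [n|f] a x y; rewrite -linearP; congr (contract _);
  apply: linear_ext => h /=.
  by rewrite scalerDl scalerA.
by rewrite scalerDr !scalerA mulrC.
Qed.
Definition contra_act : {bilinear {linear H -> k^o} -> N -> N} :=
  locked (mkbilin contra_act_bilin).
Local Notation "f ▷ n" := (contra_act f n).

Lemma contra_actE f n : f ▷ n = contract (scale_functional f n).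
Proof. by rewrite /contra_act -lock. Qed.

Lemma contra_act_counit n : ε ▷ n = n.
Proof.
rewrite contra_actE -[RHS]contract_counit; congr (contract _).
exact: linear_ext.
Qed.

Lemma contra_actA f g n : f ▷ g ▷ n = conv A f g ▷ n.
Proof.
have B : bilin (fun x y => ⟨f, x⟩ *: (⟨g, y⟩ *: n)) by lin.
rewrite !contra_actE.
transitivity (contract (contract \o curry (mklin (tsum_linear B)))).
  congr (contract _); apply: linear_ext => x /=; rewrite -linearZ.
  by congr (contract _); apply: linear_ext => y /=; rewrite tsum_tens.
rewrite contractA; congr (contract _); apply: linear_ext => h /=.
exact: tsum_scale_conv.
Qed.

Lemma tsum_contra_act (U V : lmodType k) (t : tensor U V)
    (F : U -> V -> {linear H -> k^o}) (G : U -> V -> N) (θ : {linear H -> N}) :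
  (forall x, \tsum_(u, v <- t) (⟨F u v, x⟩ *: G u v) = θ x) ->
  \tsum_(u, v <- t) (F u v ▷ G u v) = contract θ.
Proof.
move=> Fθ; under eq_tsum => u v do rewrite contra_actE.
rewrite -linear_tsum; congr (contract _); apply: linear_ext => x.
by rewrite -Fθ (linf_tsum _ _ (f := fun g : {linear H -> N} => g x)).
Qed.

End Action.
Local Notation "f ▷ n" := (contra_act _ f n).

Lemma contraHom_act (M N : contramodule A) (φ : contraHom M N) f m :
  φ (f ▷ m) = f ▷ φ m.
Proof.
rewrite !contra_actE contraHomP; congr (contract _); apply: linear_ext => x /=.
exact: linearZ.
Qed.

Lemma hat_contra_act (M : comodule A) f (φ : hat M) h :
  (f ▷ φ : hat M) h = φ (rhit A h f).
Proof. by rewrite contra_actE /= sw_rhit; last by lin. Qed.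

Fact translate_subproof f u v : linear (fun x => f (u * x * v) : k^o).
Proof. by lin. Qed.
Fact translate_bilin f : bilin (fun u v => mklin (translate_subproof f u v)).
Proof.
split=> [v|u] a x y; apply: linear_ext => z /=.
  by rewrite !mulrDl -!scalerAl linearP.
by rewrite mulrDr -scalerAr linearP.
Qed.
Definition translate f : {bilinear H -> H -> {linear H -> k^o}} :=
  locked (mkbilin (translate_bilin f)).

Lemma translateE f u v x : translate f u v x = f (u * x * v).
Proof. by rewrite /translate -lock. Qed.

Lemma aydc_contra_act (N : aydContramodule A) h f (n : N) :
  aydc_act N h (f ▷ n) =
  sw3 A h (fun h1 h2 h3 => translate f (S h3) h1 ▷ aydc_act N h2 n).
Proof.
transitivity (contract (sw3 A h (fun h1 h2 h3 =>
    scale_functional (translate f (S h3) h1) (aydc_act N h2 n)))).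
  rewrite contra_actE aydc_compat; congr (contract _); apply: linear_ext => x.
  rewrite [RHS](linf_sw3 _ _ _ (f := fun u : {linear H -> N} => u x))//.
  by apply: eq_sw3 => h1 h2 h3 /=; rewrite translateE linearZr.
by rewrite linf_sw3; [apply: eq_sw3 => *; rewrite contra_actE|lin].
Qed.

End ContraAction.

(** * Integrals *)

Section Integrals.
Variables (k : fieldType) (H : algType k) (A : hopf H).
Implicit Types (h x y : H) (p q lam : {linear H -> k^o}).
Local Notation Δ := (comul A).
Local Notation ε := (counit A).
Local Notation S := (antipode A).
Local Notation "⟨ p , h ⟩" := (p h : k).
Local Notation "p ⇀ h" := (lhit A p h).

Definition left_integral (l : H) : Prop := forall h, h * l = ε h *: l.
Definition right_integral (l : H) : Prop := forall h, l * h = ε h *: l.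
Definition left_cointegral lam : Prop := forall h, lam ⇀ h = ⟨lam, h⟩ *: 1.

Lemma cointegral_shift lam x h : left_cointegral lam ->
  \tsum_(h1, h2 <- Δ h) (⟨lam, x * h2⟩ *: h1) =
  \tsum_(x1, x2 <- Δ x) (⟨lam, x2 * h⟩ *: S x1).
Proof.
move=> lam_cointegral.
transitivity (\tsum_(h1, h2 <- Δ h) (⟨lam, x * h2⟩ *: (1 * h1))).
  by apply: eq_tsum => h1 h2; rewrite mul1r.
rewrite -(sw_cancell A x (F := fun e c =>
  \tsum_(h1, h2 <- Δ h) (⟨lam, c * h2⟩ *: (e * h1)))); last by lin.
apply: eq_tsum => x1 w.
rewrite -[S x1 in RHS]mulr1 scalerAr -lam_cointegral lhitE swM; last by lin.
rewrite mulr_tsumr; apply: eq_tsum => x2 x3; rewrite mulr_tsumr.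
by apply: eq_tsum => h1 h2; rewrite -scalerAr mulrA.
Qed.

Lemma tsum_lhit_antipode2 q x y :
  \tsum_(x1, x2 <- Δ x) (⟨q, x2 * S (S y)⟩ *: x1) =
  \tsum_(y1, y2 <- Δ y) (q ⇀ (x * S (S y2))) * S y1.
Proof.
apply/esym; transitivity (\tsum_(y1, w <- Δ y) \tsum_(y2, y3 <- Δ w)
  \tsum_(x1, x2 <- Δ x) (⟨q, x2 * S (S y3)⟩ *: (x1 * S (y1 * S y2)))).
  apply: eq_tsum => y1 w; rewrite lhitE mulr_tsuml swM; last by lin.
  rewrite [RHS]exchange_tsum; apply: eq_tsum => x1 x2.
  rewrite sw_antipode ?sw_antipode; try by lin.
  by apply: eq_tsum => y2 y3; rewrite -scalerAl antipodeM mulrA.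
rewrite (sw_cancelr A y (F := fun e c =>
  \tsum_(x1, x2 <- Δ x) (⟨q, x2 * S (S c)⟩ *: (x1 * S e)))); last by lin.
by apply: eq_tsum => x1 x2; rewrite antipode1 mulr1.
Qed.

Section TraceFormula.
Variables (I : finType) (b : I -> H) (c : I -> {linear H -> k^o}).
Hypothesis bc_dual : dual_basis b c.

Lemma sum_dual_basis_lhit z : \sum_i (c i ⇀ z) * S (b i) = ε z *: 1.
Proof.
rewrite -(antipoder A); under eq_bigr => i _.
  rewrite -(sw_lhit _ _ _ (F := fun a => a * S (b i))); last by lin.
  over.
rewrite exchange_sum_tsum; apply: eq_tsum => z1 z2.
by rewrite (sum_dual_basis bc_dual _ (F := fun x => z1 * S x)); last by lin.
Qed.

Fact trace_cointegral_linear p :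
  linear (fun x => \sum_i conv A (c i) p (x * S (S (b i))) : k^o).
Proof. by lin. Qed.
(* The trace of y |-> p ⇀ (x * S (S y)). *)
Definition trace_cointegral p : {linear H -> k^o} :=
  mklin (trace_cointegral_linear p).

Lemma left_cointegral_trace p : left_cointegral (trace_cointegral p).
Proof.
move=> x.
transitivity (\sum_i (\tsum_(y1, y2 <- Δ (b i))
    (conv A (c i) p ⇀ (x * S (S y2))) * S y1)).
  under [RHS]eq_bigr => i _ do rewrite -tsum_lhit_antipode2.
  rewrite exchange_sum_tsum lhitE; apply: eq_tsum => x1 x2.
  exact: scaler_suml.
rewrite (sum_dual_basis_comul A bc_dual (G := fun y1 y2 q =>
  (conv A q p ⇀ (x * S (S y2))) * S y1)) => [|||]; try by lin.
rewrite exchange_big scaler_suml; apply: eq_bigr => j _.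
under eq_bigr => i _ do rewrite -convA lhit_conv.
by rewrite sum_dual_basis_lhit counit_lhit.
Qed.

Lemma sum_trace_cointegral p x :
  \sum_j trace_cointegral (conv A (c j) p) (x * S (b j)) = p x.
Proof.
transitivity (\sum_i (\tsum_(y1, y2 <- Δ (b i))
   (conv A (c i) p (x * S (S y1 * y2)) : k^o))).
  rewrite (sum_dual_basis_comul A bc_dual (G := fun y1 y2 q =>
    conv A q p (x * S (S y1 * y2)))) => [|||]; try by lin.
  rewrite [RHS]exchange_big; apply: eq_bigr => j _; apply: eq_bigr => i _.
  by rewrite antipodeM mulrA convA.
under eq_bigr => i _.
  rewrite (sw_antil A (b i) (F := fun e => conv A (c i) p (x * S e)));
    last by lin.
  rewrite antipode1 mulr1; over.
rewrite (sum_dual_basis_functional bc_dual ε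
  (F := fun q => conv A q p x : k^o)); last by lin.
by rewrite conv_counitl.
Qed.

Lemma ex_left_cointegral :
  exists2 lam, left_cointegral lam & exists y, ⟨lam, y⟩ != 0.
Proof.
have [j neq0] : exists j, trace_cointegral (conv A (c j) ε) (1 * S (b j)) != 0.
  apply: contrapT => /forallNP all0; have := sum_trace_cointegral ε 1.
  rewrite big1 ?counit1 => [/eqP|j _]; first by rewrite eq_sym oner_eq0.
  by have /negP/negPn/eqP := all0 j.
exists (trace_cointegral (conv A (c j) ε)); first exact: left_cointegral_trace.
by exists (1 * S (b j)).
Qed.

Lemma left_cointegral_nondegenerate lam y h : left_cointegral lam ->
  ⟨lam, y⟩ != 0 -> (forall x, lam (x * h) = 0) -> h = 0.
Proof.
move=> lam_cointegral lam_y lam_h; apply: (scalerI lam_y); rewrite scaler0.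
have slice0 x : \tsum_(h1, h2 <- Δ h) (⟨lam, x * h2⟩ *: h1) = 0.
  rewrite cointegral_shift//; apply: big1 => z _.
  by rewrite lam_h; exact: scale0r.
pose q i : {linear H -> k^o} := c i \o (y \*o S).
transitivity (\sum_i (q i ⇀ \tsum_(h1, h2 <- Δ h) (⟨lam, b i * h2⟩ *: h1)));
  last by apply: big1 => i _; rewrite slice0 linear0r.
transitivity (\tsum_(h1, w <- Δ h) \tsum_(h2, h3 <- Δ w)
    (⟨lam, y * (S h2 * h3)⟩ *: h1)).
  under eq_tsum => h1 w.
    rewrite (sw_antil A _ (F := fun e => ⟨lam, y * e⟩ *: h1)); last by lin.
    rewrite mulr1; over.
  by rewrite (sw_counitr A _ (F := fun e => ⟨lam, y⟩ *: e))//; lin.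
rewrite -(swA A _ (F := fun h1 h2 h3 => ⟨lam, y * (S h2 * h3)⟩ *: h1));
  last by split; lin.
have Lq i : linear (fun e => q i ⇀ e) by lin.
apply/esym; under eq_bigr => i _ do rewrite (linf_tsumZ (k := k) _ _ _ (Lq i)).
rewrite exchange_sum_tsum; apply: eq_tsum => a h3.
under eq_bigr => i _ do rewrite lhitE -tsumZ.
rewrite exchange_sum_tsum; apply: eq_tsum => h1 h2.
under eq_bigr => i _ do rewrite scalerA mulrC -scalerA.
rewrite (sum_dual_basis bc_dual (y * S h2) (F := fun e => ⟨lam, e * h3⟩ *: h1));
  last by lin.
by rewrite mulrA.
Qed.

End TraceFormula.
End Integrals.

Lemma vbasis_dual_basis (k : fieldType) (V : vectType k) :
  dual_basis (fun i : 'I_(\dim {:V}) => (vbasis {:V})`_i)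
    (fun i => coord (vbasis {:V}) i : {linear V -> k^o}).
Proof. by move=> v; rewrite -coord_vbasis ?memvf. Qed.

Lemma nondegenerate_represent (k : fieldType) (V : vectType k)
    (β : {bilinear V -> V -> k^o}) (p : {linear V -> k^o}) :
  (forall v, (forall u, β u v = 0) -> v = 0) ->
  exists v, forall u, β u v = p u.
Proof.
move=> β_nondeg; pose b (i : 'I_(\dim {:V})) := (vbasis {:V})`_i.
pose f v := \sum_i ((β (b i) v : k) *: b i).
have f_linear : linear f by rewrite /f; lin.
have coord_b (x : _ -> k) i : coord (vbasis {:V}) i (\sum_j x j *: b j) = x i.
  exact: (coord_sum_free _ _ (basis_free (vbasisP {:V}))).
have f_represents v (q : {linear V -> k^o}) :
    f v = \sum_i ((q (b i) : k) *: b i) -> forall u, β u v = q u.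
  move=> fv; apply: (dual_basis_ext (@vbasis_dual_basis k V)) => [||i].
  - exact: (proj1 (bilinear_bilin β) v).
  - exact: linearP.
  - by rewrite -[LHS](coord_b (fun j => β (b j) v)) -/(f v) fv coord_b.
have f_inj : lker (linfun (mklin f_linear)) == 0%VS.
  rewrite -subv0; apply/subvP => v; rewrite memv_ker memv0 lfunE /= => /eqP fv0.
  apply/eqP/β_nondeg/(f_represents v \0); rewrite fv0 big1// => i _.
  exact: scale0r.
have : \sum_i ((p (b i) : k) *: b i) \in limg (linfun (mklin f_linear)).
  by rewrite lker0_limgf// memvf.
by case/memv_imgP=> v _; rewrite lfunE => /esym/f_represents; exists v.
Qed.

Lemma ex_dual_integrals (k : fieldType) (H : falgType k) (A : hopf H) :
  bijective (antipode A) -> exists (lam : {linear H -> k^o}) (L : H),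
  [/\ left_cointegral A lam, right_integral A L & lam (antipode A L) = 1].
Proof.
move=> [S' SK S'K].
have bc_dual := @vbasis_dual_basis k H.
have [lam lam_cointegral [y lam_y]] := ex_left_cointegral A bc_dual.
have B : bilin (fun x h => lam (x * h) : k^o) by lin.
have nondeg := left_cointegral_nondegenerate bc_dual lam_cointegral lam_y.
have [l lam_l] := nondegenerate_represent (β := mkbilin B) (counit A) nondeg.
have {}lam_l x : lam (x * l) = counit A x by exact: lam_l.
have l_left : left_integral A l.
  move=> h; apply/eqP; rewrite -subr_eq0; apply/eqP/nondeg => x.
  rewrite mulrBr mulrA -scalerAr linearB linearZ /= !lam_l counitM.
  by rewrite [_ *: _]mulrC subrr.
exists lam, (S' l); split=> // [h|]; last first.
  by rewrite S'K -[l]mul1r lam_l counit1.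
apply: (can_inj SK).
by rewrite antipodeM S'K l_left linearZ /= S'K counit_antipode.
Qed.

(** * The Frobenius form and the modular character *)

Section Frobenius.
Variables (k : fieldType) (H : algType k) (A : hopf H).
Implicit Types (g h x y : H).
Local Notation Δ := (comul A).
Local Notation ε := (counit A).
Local Notation S := (antipode A).
Local Notation "⟨ p , h ⟩" := (p h : k).
Local Notation "p ⇀ h" := (lhit A p h).
Local Notation "h ↼ p" := (rhit A h p).
Local Notation "f ▷ n" := (contra_act _ f n).

Variables (lam : {linear H -> k^o}) (L : H).
Hypothesis S_bij : bijective S.
Hypothesis lam_cointegral : left_cointegral A lam.
Hypothesis L_integral : right_integral A L.
Hypothesis lam_SL : lam (S L) = 1.

Fact frobenius_subproof x : linear (fun h => lam (x * S h) : k^o).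
Proof. by lin. Qed.
Fact frobenius_linear : linear (fun x => mklin (frobenius_subproof x)).
Proof.
move=> a x y; apply: linear_ext => h.
by rewrite /= mulrDl -scalerAl linearP.
Qed.
Definition frobenius : {linear H -> {linear H -> k^o}} :=
  locked (mklin frobenius_linear).

Lemma frobeniusE x h : frobenius x h = lam (x * S h).
Proof. by rewrite /frobenius -lock. Qed.

Lemma left_integral_antipode : left_integral A (S L).
Proof.
move=> h; have [S' _ S'K] := S_bij.
by rewrite -[h]S'K -antipodeM L_integral linearZ /= counit_antipode.
Qed.

Lemma frobenius_integralr x : frobenius x L = ε x.
Proof.
by rewrite frobeniusE left_integral_antipode linearZ /= lam_SL; exact: mulr1.
Qed.

Lemma rhit_frobenius x h :
  h ↼ frobenius x = \tsum_(x1, x2 <- Δ x) (⟨frobenius x2, h⟩ *: x1).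
Proof.
apply: (bij_inj S_bij); rewrite linear_tsum rhitE linear_tsum.
transitivity (\tsum_(h1, h2 <- Δ (S h)) (⟨lam, x * h2⟩ *: h1)).
  rewrite sw_antipode; last by lin.
  by apply: eq_tsum => h1 h2; rewrite linearZ frobeniusE.
rewrite cointegral_shift//; apply: eq_tsum => x1 x2.
by rewrite linearZ frobeniusE.
Qed.

Lemma integral_rhit_frobenius x : L ↼ frobenius x = x.
Proof.
rewrite rhit_frobenius -[RHS](counitr A x); apply: eq_tsum => x1 x2.
by rewrite frobenius_integralr.
Qed.

Lemma sw_frobeniusl (W : lmodType k) x (F : H -> W) : linear F ->
  \tsum_(a, b <- Δ L) (⟨frobenius x, a⟩ *: F b) = F x.
Proof. by move=> LF; rewrite sw_rhit// integral_rhit_frobenius. Qed.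

Lemma cointegral_integral : lam L = 1.
Proof.
have frobL : frobenius L = ⟨lam, L⟩ *: (ε : {linear H -> k^o}).
  apply: linear_ext => h.
  by rewrite frobeniusE L_integral linearZ /= counit_antipode; exact: mulrC.
have := congr1 (lam \o S) (integral_rhit_frobenius L).
rewrite frobL linearZr rhit_counit /= !linearZ /= lam_SL => <-.
exact/esym/mulr1.
Qed.

Lemma frobenius_integral : frobenius L = ε.
Proof.
apply: linear_ext => h.
rewrite frobeniusE L_integral linearZ /= counit_antipode.
by rewrite cointegral_integral; exact: mulr1.
Qed.

Lemma sw_frobeniusr (W : lmodType k) h (F : H -> W) : linear F ->
  \tsum_(a, b <- Δ L) (⟨frobenius b, h⟩ *: F a) = F h.
Proof.
move=> LF; rewrite -linf_tsumZ// -rhit_frobenius.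
by rewrite frobenius_integral rhit_counit.
Qed.

Lemma conv_frobenius x y :
  conv A (frobenius x) (frobenius y) = frobenius (x ↼ frobenius y).
Proof.
apply: linear_ext => h; rewrite conv_rhit rhit_frobenius linear_tsum.
rewrite -(sw_rhit _ _ _ (F := fun x => frobenius x h : k^o)); last by lin.
by apply: eq_tsum => x1 x2; rewrite linearZ; exact: mulrC.
Qed.

Fact modular_linear : linear (fun h => lam (h * L) : k^o).
Proof. by lin. Qed.
Definition modular : {linear H -> k^o} := locked (mklin modular_linear).
Local Notation χ := modular.

Lemma modularE h : χ h = lam (h * L).
Proof. by rewrite /modular -lock. Qed.

Lemma mul_integral h : h * L = ⟨χ, h⟩ *: L.
Proof.
have [d hL] : exists d : k, h * L = d *: L.
  exists (lam (S L * S h)); set d : k := lam _.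
  rewrite -[LHS](sw_frobeniusr _ (@lin_id _ _)) -[L in RHS](counitr A) -tsumZ.
  apply: eq_tsum => a b; rewrite frobeniusE antipodeM mulrA.
  by rewrite left_integral_antipode -scalerAl linearZ /= scalerA mulrC.
by rewrite modularE hL linearZ /= cointegral_integral [_ *: 1]mulr1.
Qed.

Lemma integral_translate x y : x * L * y = ε y *: (⟨χ, x⟩ *: L).
Proof. by rewrite mul_integral -scalerAl L_integral !scalerA mulrC. Qed.

Lemma sw_integral_translate (W : lmodType k) x y (F : H -> H -> W) : bilin F ->
  \tsum_(y1, y2 <- Δ y) \tsum_(x1, x2 <- Δ x) \tsum_(a, b <- Δ L)
    F (x1 * a * S y2) (x2 * b * S y1) = ε y *: (⟨χ, x⟩ *: tsum (Δ L) F).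
Proof.
move=> BF; have LF : linear (fun z => tsum (Δ z) F) by lin.
rewrite -(counit_antipode A) -!(scalable_linear LF) /= -integral_translate.
rewrite swM// swM; last by lin.
rewrite [LHS]exchange_tsum; apply: eq_tsum => x1 x2.
rewrite [LHS]exchange_tsum; apply: eq_tsum => a b.
by rewrite sw_antipode; last by lin.
Qed.

Lemma modular1 : χ 1 = 1.
Proof. by rewrite modularE mul1r cointegral_integral. Qed.

Lemma modularM : {morph χ : g h / g * h}.
Proof.
move=> g h; rewrite modularE -mulrA mul_integral -scalerAr linearZ /= -modularE.
exact: mulrC.
Qed.

Lemma cointegral_mulC u h : lam (u * S (S (χ ⇀ h))) = lam (h * u).
Proof.
rewrite -frobeniusE (_ : S (χ ⇀ h) = \tsum_(a, b <- Δ L) (⟨lam, h * b⟩ *: a)).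
  rewrite -[u in RHS](sw_frobeniusl u (@lin_id _ _)) mulr_tsumr !linear_tsum.
  by apply: eq_tsum => a b; rewrite -scalerAr !linearZ; exact: mulrC.
rewrite cointegral_shift// lhitE linear_tsum; apply: eq_tsum => h1 h2.
by rewrite linearZ modularE.
Qed.

(** * Comodules from contramodules *)

Section UnhatObject.
Variable N : contramodule A.

Fact unhat_coact_linear :
  linear (fun n : N => \tsum_(a, b <- Δ L) (frobenius a ▷ n ⊗ b)).
Proof. by lin. Qed.
Definition unhat_coact : {linear N -> tensor N H} :=
  locked (mklin unhat_coact_linear).

Lemma unhat_coactE n :
  unhat_coact n = \tsum_(a, b <- Δ L) (frobenius a ▷ n ⊗ b).
Proof. by rewrite /unhat_coact -lock. Qed.

Lemma tsum_unhat_coact (W : lmodType k) n (F : N -> H -> W) : bilin F ->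
  tsum (unhat_coact n) F = \tsum_(a, b <- Δ L) F (frobenius a ▷ n) b.
Proof.
move=> BF; rewrite unhat_coactE tsum_tsum//.
by apply: eq_tsum => a b; rewrite tsum_tens.
Qed.

Fact unhat_coactA n :
  \tsum_(m0, m1 <- unhat_coact n)
    \tsum_(m00, m01 <- unhat_coact m0) (m00 ⊗ (m01 ⊗ m1)) =
  \tsum_(m0, m1 <- unhat_coact n) \tsum_(a, b <- Δ m1) (m0 ⊗ (a ⊗ b)).
Proof.
rewrite !tsum_unhat_coact; try by lin.
rewrite -(swA A L (F := fun c d b => frobenius c ▷ n ⊗ (d ⊗ b)));
  last by split; lin.
apply: eq_tsum => a b; rewrite tsum_unhat_coact; last by lin.
rewrite -[in RHS](integral_rhit_frobenius a) comul_rhit; last by lin.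
by apply: eq_tsum => c d; rewrite contra_actA conv_frobenius.
Qed.

Fact unhat_coact_counit n : \tsum_(m0, m1 <- unhat_coact n) (ε m1 *: m0) = n.
Proof.
rewrite tsum_unhat_coact; last by lin.
rewrite (sw_counitr A L (F := fun a => frobenius a ▷ n)); last by lin.
by rewrite frobenius_integral contra_act_counit.
Qed.

Definition unhat : comodule A := Comodule unhat_coactA unhat_coact_counit.
End UnhatObject.

Fact unhat_mor_colinear (M N : contramodule A) (f : contraHom M N) :
  (f : {linear unhat M -> unhat N}) \in @colinear _ _ A (unhat M) (unhat N).
Proof.
apply/asboolP => m; rewrite tsum_unhat_coact; last by lin.
by rewrite /= unhat_coactE; apply: eq_tsum => a b; rewrite contraHom_act.
Qed.
Definition unhat_mor (M N : contramodule A) (f : contraHom M N) :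
  comodHom (unhat M) (unhat N) := ComodHom (unhat_mor_colinear f).

Definition unhat_functor : functor (contra_cat A) (comod_cat A).
Proof.
by refine (@Functor (contra_cat A) (comod_cat A) unhat unhat_mor _ _) => *;
  apply: comodHom_ext.
Defined.

Section Evaluation.
Variable M : comodule A.

Fact coev_fun_subproof (m : M) :
  linear (fun h => \tsum_(m0, m1 <- coact m) (⟨frobenius m1, h⟩ *: m0)).
Proof. by lin. Qed.
Definition coev_fun m : {linear H -> M} := mklin (coev_fun_subproof m).

Fact coev_colinear m :
  (coev_fun m : {linear regular A -> M}) \in @colinear _ _ A (regular A) M.
Proof.
apply/asboolP => h /=; rewrite linear_tsum.
transitivity (\tsum_(m0, m1 <- coact m) \tsum_(m00, m01 <- coact m0)
   (⟨frobenius m1, h⟩ *: (m00 ⊗ m01))).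
  apply: eq_tsum => m0 m1.
  by rewrite linearZ /= {1}(tensor_tsum (coact m0)) tsumZ.
rewrite (sw_coactA m (F := fun m0 a b => ⟨frobenius b, h⟩ *: (m0 ⊗ a)));
  try by lin.
transitivity (\tsum_(m0, m1 <- coact m) \tsum_(h1, h2 <- Δ h)
   (⟨frobenius m1, h1⟩ *: (m0 ⊗ h2))).
  apply: eq_tsum => m0 m1; have Lm0 : linear (fun x : H => m0 ⊗ x) by lin.
  by rewrite -!(linf_tsumZ _ _ _ Lm0) -rhit_frobenius rhitE.
rewrite exchange_tsum; apply: eq_tsum => h1 h2.
have Lh2 : linear (fun x : M => x ⊗ h2) by lin.
exact/esym/(linf_tsumZ _ _ _ Lh2).
Qed.
Definition coev m : hat M := ComodHom (coev_colinear m).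

Fact ev_linear : linear (fun φ : hat M => φ L).
Proof. by []. Qed.
Definition ev : {linear hat M -> M} := mklin ev_linear.

Lemma evK : cancel ev coev.
Proof.
move=> φ; apply: comodHom_ext => h /=; rewrite hatP tsum_tsum; last by lin.
rewrite -[RHS](sw_frobeniusr h (F := φ)); last by lin.
by apply: eq_tsum => a b; rewrite tsum_tens; last by lin.
Qed.

Lemma coevK : cancel coev ev.
Proof.
move=> m /=; rewrite -[RHS](coact_counit m); apply: eq_tsum => m0 m1.
by rewrite frobenius_integralr.
Qed.

Lemma ev_bij : bijective ev.
Proof. exact: Bijective evK coevK. Qed.

Fact ev_colinear :
  (ev : {linear unhat (hat M) -> M}) \in @colinear _ _ A (unhat (hat M)) M.
Proof.
apply/asboolP => φ; rewrite tsum_unhat_coact; last by lin.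
rewrite /= hatP; apply: eq_tsum => a b.
by rewrite hat_contra_act integral_rhit_frobenius.
Qed.
Definition ev_comod : comodHom (unhat (hat M)) M := ComodHom ev_colinear.
End Evaluation.

Section EvaluationContra.
Variable N : contramodule A.

Lemma hat_unhat_frobenius (φ : hat (unhat N)) h :
  φ h = frobenius h ▷ (φ L : N) :> N.
Proof.
rewrite -{1}[φ]evK /= tsum_unhat_coact; last by lin.
rewrite (sw_frobeniusr h (F := fun a => frobenius a ▷ (φ L : N))) //; lin.
Qed.

Local Notation evN := (ev (unhat N) : {linear hat (unhat N) -> N}).

Fact ev_contract (θ : {linear H -> hat (unhat N)}) :
  evN (contract θ) = contract (evN \o θ).
Proof.
rewrite /=; under eq_tsum => a b do rewrite hat_unhat_frobenius.
apply: tsum_contra_act => x.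
by have := sw_frobeniusr x (linearP (evN \o θ)).
Qed.
Definition ev_contra : contraHom (hat (unhat N)) N := ContraHom ev_contract.
End EvaluationContra.

Lemma hat_functor_equivalence : is_equivalence (hat_functor A).
Proof.
exists unhat_functor; split.
  apply: nat_iso_sym; exists ev_comod; split=> [M|M N f].
    exact/comodHom_is_iso/ev_bij.
  exact: comodHom_ext.
exists ev_contra; split=> [N|M N f]; last exact: contraHom_ext.
exact/contraHom_is_iso/(ev_bij (unhat N)).
Qed.

(** * Anti-Yetter-Drinfeld structures *)

Section ModularAction.
Variables (N : lmodType k) (act : {bilinear H -> N -> N}).

Fact modular_act_bilin : bilin (fun h n => act (χ ⇀ h) n).
Proof. by lin. Qed.
Definition modular_act : {bilinear H -> N -> N} :=
  locked (mkbilin modular_act_bilin).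

Lemma modular_actE h n : modular_act h n = act (χ ⇀ h) n.
Proof. by rewrite /modular_act -lock. Qed.

Lemma modular_actP : is_action act -> is_action modular_act.
Proof.
move=> [act1 actM]; split=> [n|g h n]; rewrite !modular_actE.
  by rewrite (lhit_char1 _ modular1).
by rewrite (lhit_charM _ modularM) actM.
Qed.

Lemma twist_integral h (f : {linear H -> N}) :
  twist A act h f L = act ((χ \o S) ⇀ h) (f L).
Proof.
rewrite -(sw_lhit _ h (χ \o S) (F := fun x => act x (f L))); last by lin.
rewrite -sw3_counitl; last by lin.
apply: eq_sw3 => h1 h2 h3.
by rewrite integral_translate !linearZ /= !scalerA mulrC.
Qed.

End ModularAction.

Section UnhatAydObject.
Variable N : aydContramodule A.
Local Notation act := (aydc_act N).

Lemma modular_act_frobenius h a (n : N) :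
  modular_act act h (frobenius a ▷ n) =
  sw3 A h (fun h1 h2 h3 => frobenius (h3 * a * S h1) ▷ act h2 n).
Proof.
rewrite modular_actE aydc_contra_act sw3_lhit; last by split; lin.
apply: eq_sw3 => h1 h2 h3; congr (_ ▷ _); apply: linear_ext => x.
rewrite translateE !frobeniusE !antipodeM !mulrA cointegral_mulC.
by rewrite !mulrA.
Qed.

Fact unhat_ayd_compat h (n : unhat N) :
  coact (modular_act act h n : unhat N) =
  sw3 A h (fun h1 h2 h3 => \tsum_(m0, m1 <- coact n)
    ((modular_act act h2 m0 : unhat N) ⊗ h3 * m1 * S h1)).
Proof.
pose F (m : N) x y : tensor (unhat N) H := (frobenius x ▷ m : unhat N) ⊗ y.
apply/esym; transitivity (sw3 A h (fun h1 w h3 => sw3 A w (fun g1 g2 g3 =>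
    \tsum_(a, b <- Δ L) F (act g2 n) (g3 * a * S g1) (h3 * b * S h1)))).
  apply: eq_sw3 => h1 w h3; rewrite tsum_unhat_coact; last by lin.
  rewrite -exchange_tsum_sw3; apply: eq_tsum => a b.
  rewrite modular_act_frobenius.
  by rewrite (linf_sw3 A _ _ (f := fun m => m ⊗ _)); last by lin.
rewrite (sw3_sw3 A h (F := fun h1 g1 g2 g3 h3 =>
    \tsum_(a, b <- Δ L) F (act g2 n) (g3 * a * S g1) (h3 * b * S h1)));
  try by rewrite /F; lin.
transitivity (sw3 A h (fun u m v =>
    ε u *: (⟨χ, v⟩ *: unhat_coact N (act m n)))).
  apply: eq_sw3 => u m v; rewrite unhat_coactE.
  rewrite -(sw_integral_translate _ _ (F := F (act m n))) //.
  by rewrite /F; lin.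
rewrite sw3_counitl; last by lin.
by rewrite /= modular_actE sw_lhit; last by lin.
Qed.

Definition unhat_ayd : aydModule A :=
  @AydModule _ _ _ (unhat N) _ (modular_actP (aydc_actP N)) unhat_ayd_compat.

End UnhatAydObject.

Fact unhat_ayd_mor_act (M N : aydContramodule A) (f : aydcHom M N) h m :
  unhat_mor f (ayd_act (unhat_ayd M) h m) =
  ayd_act (unhat_ayd N) h (unhat_mor f m).
Proof. by rewrite /= !modular_actE aydcHomP. Qed.
Definition unhat_ayd_mor (M N : aydContramodule A) (f : aydcHom M N) :
    aydHom (unhat_ayd M) (unhat_ayd N) :=
  @AydHom _ _ _ (unhat_ayd M) (unhat_ayd N) (unhat_mor f) (unhat_ayd_mor_act f).

Definition unhat_ayd_functor : functor (aydc_cat A) (ayd_cat A).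
Proof.
by refine (@Functor (aydc_cat A) (ayd_cat A) unhat_ayd unhat_ayd_mor _ _) => *;
  apply: aydHom_ext.
Defined.

Fact ev_comod_act (M : aydModule A) h φ :
  ev_comod M (ayd_act (unhat_ayd (hat_ayd M)) h φ) =
  ayd_act M h (ev_comod M φ).
Proof.
rewrite /= modular_actE [LHS]twist_integral -lhit_conv.
by rewrite (conv_antipode_char A modular1 modularM) lhit_counit.
Qed.
Definition ev_ayd (M : aydModule A) : aydHom (unhat_ayd (hat_ayd M)) M :=
  @AydHom _ _ _ (unhat_ayd (hat_ayd M)) M (ev_comod M) (@ev_comod_act M).

Fact ev_contra_act (N : aydContramodule A) h φ :
  ev_contra N (aydc_act (hat_ayd (unhat_ayd N)) h φ) =
  aydc_act N h (ev_contra N φ).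
Proof.
rewrite [LHS](twist_integral (ayd_act (unhat_ayd N)) h φ) /= modular_actE.
by rewrite -lhit_conv (conv_char_antipode A modular1 modularM) lhit_counit.
Qed.
Definition ev_aydc (N : aydContramodule A) :
    aydcHom (hat_ayd (unhat_ayd N)) N :=
  @AydcHom _ _ _ (hat_ayd (unhat_ayd N)) N (ev_contra N) (@ev_contra_act N).

Lemma hat_ayd_functor_equivalence : is_equivalence (hat_ayd_functor A).
Proof.
exists unhat_ayd_functor; split.
  apply: nat_iso_sym; exists ev_ayd; split=> [M|M N f].
    exact/aydHom_is_iso/ev_bij.
  exact: aydHom_ext.
exists ev_aydc; split=> [N|M N f]; last exact: aydcHom_ext.
exact/aydcHom_is_iso/(ev_bij (unhat N)).
Qed.

End Frobenius.

Theorem proposition4p4 (k : fieldType) (char0 : [pchar k] =i pred0)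
    (H : falgType k) (A : hopf H) (bijS : bijective (antipode A)) :
  is_equivalence (hat_functor A) /\ is_equivalence (hat_ayd_functor A).
Proof.
have [lam [L [lam_cointegral L_integral lam_SL]]] := ex_dual_integrals bijS.
split.
  exact: hat_functor_equivalence bijS lam_cointegral L_integral lam_SL.
exact: hat_ayd_functor_equivalence bijS lam_cointegral L_integral lam_SL.
Qed.
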